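(* Let $\Phi^t\colon X\to X$ $(t\in\mathbb R)$ be a continuous flow on a metrizable space $X$ with an ergodic invariant Borel probability measure $\mu$ with compact support $X_\mu$, such that $X_\mu\subseteq M$ for a compact $C^1$ manifold $M\subseteq X$ that is forward-invariant ($\Phi^t(M)\subseteq M$ for $t\ge 0$) and on which $\Phi^t$ is generated by a continuous vector field. Let $H=L^2(\mu)$, let $U^t\colon H\to H$, $U^tf=f\circ\Phi^t$, be the Koopman operators, and let $\iota\colon C(M)\to H$ be the map sending a continuous function to its $\mu$-equivalence class. Let $k_\tau$, $\mathcal H_\tau$, $K_\tau$, $G_\tau$ $(\tau>0)$ be kernels, reproducing kernel Hilbert spaces and operators with the properties listed in the context; let $V_\tau$ be a family of regularized generators with the properties listed in the context, with associated unitaries $U^t_\tau=e^{tW_\tau}$ on $\mathcal H_\tau$; let $w\colon\mathbb N_0\to\mathbb R_{>0}$ satisfy $w(0)=1$, $w^{-2}\in\ell^1(\mathbb N_0)$ and $w^{-2}*w^{-2}\le C w^{-2}$ for some constant $C$; and let $\kappa\colon X\times X\to\mathbb R_{>0}$ be a strictly positive, bounded, continuous kernel with $\kappa(x,y)<\kappa(x,x)$ for all $x\ne y$ in $X$. For $f\in C(M)$, $t\in\mathbb R$, $m\in\mathbb N$, $\sigma>0$, and sufficiently small $\tau\in(0,\sigma/2]$, let $f^{(t)}_{m,\sigma,\tau}\in C(M)$ be the function $$f^{(t)}_{m,\sigma,\tau}(x)=\frac{\hat g^{(t)}_{m,\tau}\big(\hat\varphi^{(\mu)}_{\sigma,\tau}(x)\big)}{\hat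 h^{(t)}_{m,\tau}\big(\hat\varphi^{(\mu)}_{\sigma,\tau}(x)\big)},\qquad x\in M,$$ with $\hat g^{(t)}_{m,\tau}$, $\hat h^{(t)}_{m,\tau}$, $\hat\varphi^{(\mu)}_{\sigma,\tau}$ as defined in the context. Then, for every $f\in C(M)$ and every $t\in\mathbb R$, $$\lim_{m\to\infty}\ \lim_{\sigma\to 0^+}\ \lim_{\tau\to 0^+}\ \big\lVert \iota f^{(t)}_{m,\sigma,\tau}-U^t\iota f\big\rVert_H=0 .$$
   Context: All vector spaces are complex, Hilbert spaces are separable, inner products are conjugate-linear in the first argument. **Generator.** $V\colon D(V)\to H$ is the skew-adjoint generator of the strongly continuous unitary group $\{U^t\}_{t\in\mathbb R}$ on $H$, $Vf=\lim_{t\to0}(U^tf-f)/t$. That $\Phi^t|_M$ is generated by the continuous vector field $\vec V\colon M\to TM$ means $\iota(\vec V\cdot\nabla f)=V\iota f$ for $f\in C^1(M)$. **Kernels and RKHSs.** For each $\tau>0$, $k_\tau\colon X\times X\to\mathbb R_{>0}$ is a bounded, continuous, strictly positive-definite kernel whose restriction to $M\times M$ is $C^1$; $\mathcal H_\tau$ is its reproducing kernel Hilbert space (RKHS) of functions on $X$. For $S\subseteq X$, $\mathcal H_\tau(S)$ is the closed span in $\mathcal H_\tau$ of $\{k_\tau(x,\cdot):x\in S\}$. $K_\tau\colon H\to\mathcal H_\tau$ is $K_\tau f=\int_X k_\tau(\cdot,x)f(x)\,d\mu(x)$; its adjoint $K_\tau^*\colon\mathcal H_\tau\to H$ is the inclusion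 map (function to $\mu$-equivalence class). $G_\tau=K_\tau^*K_\tau$ for $\tau>0$, and $G_0=\mathrm{Id}_H$. It is assumed that: (K1) $\langle f,G_\tau f\rangle_H>0$ for $f\neq0$; (K2) $G_\tau 1_X=1_X$ and $G_\tau f\ge0$ whenever $f\ge0$; (K3) $G_\tau G_{\tau'}=G_{\tau+\tau'}$ for $\tau,\tau'\ge0$; (K4) $\lim_{\tau\to0^+}G_\tau f=f$ for all $f\in H$. The kernels are Markovian with respect to $\mu$: $\int_X k_\tau(x,y)\,d\mu(y)=1$ for $x\in M$. There is a polar decomposition $K_\tau=T_\tau G_{\tau/2}$ with $T_\tau\colon H\to\mathcal H_\tau$ an isometry with range $\mathcal H_\tau(X_\mu)$; moreover $\operatorname{ran}K_{\tau/2}=\mathcal H_\tau(X_\mu)$, and for $\tau\le\sigma$ one has $\mathcal H_\sigma\subseteq\mathcal H_\tau$ with $\lVert\cdot\rVert_{\mathcal H_\tau}\le\lVert\cdot\rVert_{\mathcal H_\sigma}$ on $\mathcal H_\sigma$. **Regularized generators.** $V_\tau\colon D(V_\tau)\to H$, $\tau>0$, are densely defined operators such that: (V1) $V_\tau$ is skew-adjoint; (V2) $V_\tau$ is compact or has compact resolvent; (V3) $V_\tau$ commutes with complex conjugation; (V4) $V_\tau1_X=0$; (V5) $V_\tau\to V$ in strong resolvent sense as $\tau\to0^+$, i.e. $(z-V_\tau)^{-1}\to(z-V)^{-1}$ strongly for some (equivalently every) $z\in\mathbb C\setminus i\mathbb R$. Set $W_\tau=T_\tau V_\tau T_\tau^*$,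 a skew-adjoint operator on $\mathcal H_\tau$ with domain $T_\tau(D(V_\tau))\oplus\ker T_\tau^*$, and $U^t_\tau=e^{tW_\tau}$, a unitary on $\mathcal H_\tau$. It is also assumed that for every $\tau_0>0$, $f\in\mathcal H_{\tau_0}$ and $t\in\mathbb R$: $\lim_{\tau\to0^+}\lVert K_\tau^*U^t_\tau f-U^t\iota f\rVert_H=0$ (here $\tau\le\tau_0$ and $\iota f$ denotes the class of $f$ in $H$). **Weighted symmetric Fock space.** For a Hilbert space $\mathcal H$, the symmetric tensor product is $f_1\vee\cdots\vee f_n=\frac1{n!}\sum_{s\in S_n}f_{s(1)}\otimes\cdots\otimes f_{s(n)}$, and $\mathcal H^{\vee n}$ is the closed subspace of symmetric tensors in $\mathcal H^{\otimes n}$. $F_w(\mathcal H)$ is the Hilbert space completion of $\mathbb C\oplus\mathcal H\oplus\mathcal H^{\vee2}\oplus\cdots$ for the inner product in which different degrees are orthogonal, $\langle a,b\rangle=\bar ab$ on $\mathbb C$, and $\langle f_1\vee\cdots\vee f_n,g_1\vee\cdots\vee g_n\rangle_{F_w(\mathcal H)}=\frac{w^2(n)}{n!^2}\sum_{s,s'\in S_n}\prod_{i=1}^n\langle f_{s(i)},g_{s'(i)}\rangle_{\mathcal H}$. Under the hypotheses on $w$ it is a unital commutative Banach algebra under $\vee$ (for an equivalent norm). Its spectrum $\sigma(F_w(\mathcal H))$ is the set of nonzero multiplicative linear functionals with the weak-$^*$ topology. $\Gamma\colon F_w(\mathcal H_\tau)\to C(\sigma(F_w(\mathcal H_\tau)))$,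 $(\Gamma f)(\chi)=\chi f$, is the Gelfand map. **Lifted dynamics.** $\tilde U^t_\tau$ is the unitary on $F_w(\mathcal H_\tau)$ fixing the degree-0 component and satisfying $\tilde U^t_\tau(f_1\vee\cdots\vee f_n)=(U^t_\tau f_1)\vee\cdots\vee(U^t_\tau f_n)$. $R^t_\tau(\chi)=\chi\circ\tilde U^t_\tau$ is the induced flow on $\sigma(F_w(\mathcal H_\tau))$, and $\hat U^t_\tau\hat f=\hat f\circ R^t_\tau$ for $\hat f\in C(\sigma(F_w(\mathcal H_\tau)))$. **Embedding of observables.** $\kappa_\tau(\cdot,y)=K_\tau\iota\kappa(\cdot,y)\in\mathcal H_\tau$. For $m\in\mathbb N$, $\mathcal K_{m,\tau}\colon H\to F_w(\mathcal H_\tau)$, $\mathcal K_{m,\tau}u=\int_X\kappa_\tau(\cdot,y)^{\vee m}u(y)\,d\mu(y)$ (weak integral), and $\hat{\mathcal K}_{m,\tau}=\Gamma\mathcal K_{m,\tau}$. For $f\in C(M)$: $\hat g^{(t)}_{m,\tau}=\hat U^t_\tau\hat{\mathcal K}_{m,\tau}\iota f$ and $\hat h^{(t)}_{m,\tau}=\hat U^t_\tau\hat{\mathcal K}_{m,\tau}1_X$. **Feature map.** For $\sigma>0$: $\varphi_\sigma(x)=k_\sigma(x,\cdot)\in\mathcal H_\sigma$; $\varphi^{(\mu)}_\sigma(x)$ is the orthogonal projection (in $\mathcal H_\sigma$) of $\varphi_\sigma(x)$ onto $\mathcal H_\sigma(X_\mu)$; $\varpi_\sigma=\sup_{x\in X}\lVert\varphi_\sigma(x)\rVert_{\mathcal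 H_\sigma}$; $\tilde\varphi^{(\mu)}_\sigma(x)=\sum_{n=0}^\infty\frac{w^{-2}(n)}{\varpi_\sigma^n}\varphi^{(\mu)}_\sigma(x)^{\vee n}$. For $\tau\in(0,\sigma/2]$, using $\mathcal H_\sigma\subseteq\mathcal H_\tau$, $\tilde\varphi^{(\mu)}_\sigma(x)$ is regarded as an element of $F_w(\mathcal H_\tau)$, and $\hat\varphi^{(\mu)}_{\sigma,\tau}(x)=\langle\tilde\varphi^{(\mu)}_\sigma(x),\cdot\rangle_{F_w(\mathcal H_\tau)}\in\sigma(F_w(\mathcal H_\tau))$. For fixed $t,m,\sigma$ and all sufficiently small $\tau$, the function $\hat h^{(t)}_{m,\tau}\circ\hat\varphi^{(\mu)}_{\sigma,\tau}$ is bounded away from zero on $M$, so $f^{(t)}_{m,\sigma,\tau}$ is a well-defined element of $C(M)$. *)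

(* Defs.v *)
From HB Require Import structures.
From mathcomp Require Import all_boot all_order all_algebra.
From mathcomp Require Import perm sesquilinear complex.
From mathcomp Require Import all_classical all_reals all_analysis.

Set Implicit Arguments.
Unset Strict Implicit.
Unset Printing Implicit Defensive.

Import Order.TTheory GRing.Theory Num.Theory.
Import numFieldNormedType.Exports.

Local Open Scope classical_set_scope.
Local Open Scope ring_scope.

(* R[i] is a normed space over itself, with the topology of the modulus. *)
HB.instance Definition _ (R : rcfType) := NormedModule.copy R[i] (R[i])^o.

Section hilbert.
Variable R : realType.
Local Notation C := R[i].

(* [hform] is linear in its FIRST argument (library convention); [hdot] below
   swaps the arguments so that it is conjugate-linear in the first one. *)
Record hilbertType := HilbertType {
  hcarrier :> completeNormedModType C ;
  hform : {dot hcarrier for (@Num.conj C)} ;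
  hform_norm : forall x : hcarrier, hform x x = `|x| ^+ 2 ;
  hseparable : exists s : nat -> hcarrier, dense (range s) }.

Definition hdot (H : hilbertType) (x y : H) : C := hform H y x.

Definition hnorm (H : hilbertType) (x : H) : R := complex.Re `|x|.

Definition closed_span (H : hilbertType) (S : set H) : set H :=
  closure [set h | exists n (c : 'I_n -> C) (s : 'I_n -> H),
    (forall i, S (s i)) /\ h = \sum_(i < n) c i *: s i].

Definition is_adjoint (H1 H2 : hilbertType) (A : H1 -> H2) (B : H2 -> H1) :=
  forall x y, hdot (A x) y = hdot x (B y).

Definition is_linear (H1 H2 : hilbertType) (A : H1 -> H2) :=
  forall (a : C) x y, A (a *: x + y) = a *: A x + A y.

Definition is_isometry (H1 H2 : hilbertType) (A : H1 -> H2) :=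
  is_linear A /\ forall x y, hdot (A x) (A y) = hdot x y.

Definition unitary_op (H : hilbertType) (U : H -> H) :=
  is_isometry U /\ set_surj setT setT U.

Definition is_orthogonal_projection (H : hilbertType) (S : set H) (x p : H) :=
  S p /\ forall s, S s -> hdot s (x - p) = 0.

Definition compact_operator (H : hilbertType) (A : H -> H) :=
  is_linear A /\ compact (closure (A @` [set x | `|x| <= 1])).

(* A possibly unbounded operator; the values of [op] outside [dom] are
   irrelevant. *)
Record operator (H : hilbertType) := Operator { dom : set H ; op :> H -> H }.

Definition is_operator (H : hilbertType) (A : operator H) :=
  dom A 0 /\ forall (a : C) x y, dom A x -> dom A y ->
    dom A (a *: x + y) /\ A (a *: x + y) = a *: A x + A y.

(* (g, h) belongs to the graph of the adjoint of A *)
Definition adjoint_graph (H : hilbertType) (A : operator H) (g h : H) :=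
  forall f, dom A f -> hdot g (A f) = hdot h f.

Definition skew_adjoint (H : hilbertType) (A : operator H) :=
  [/\ is_operator A, dense (dom A) &
      forall g h, adjoint_graph A g h <-> dom A g /\ h = - A g].

(* S = (z - A)^-1 *)
Definition is_resolvent (H : hilbertType) (A : operator H) (z : C) (S : H -> H) :=
  [/\ is_linear S, continuous S,
      (forall g, dom A (S g) /\ z *: S g - A (S g) = g) &
      (forall f, dom A f -> S (z *: f - A f) = f)].

Definition compact_or_compact_resolvent (H : hilbertType) (A : operator H) :=
  (dom A = setT /\ compact_operator A) \/
  exists z S, is_resolvent A z S /\ compact_operator S.

Definition strong_resolvent_cvg (H : hilbertType) (A : R -> operator H)
    (A0 : operator H) :=
  exists z : C, complex.Re z != 0 /\
  exists (S : R -> H -> H) (S0 : H -> H),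
    [/\ forall tau, 0 < tau -> is_resolvent (A tau) z (S tau),
        is_resolvent A0 z S0 &
        forall g, S tau g @[tau --> (0 : R)^'+] --> S0 g].

Definition unitary_group (H : hilbertType) (U : R -> H -> H) :=
  [/\ forall t, unitary_op (U t), forall x, U 0 x = x,
      forall s t x, U (s + t) x = U s (U t x) &
      forall x, continuous (fun t => U t x)].

Definition is_generator (H : hilbertType) (U : R -> H -> H) (A : operator H) :=
  forall f g, (dom A f /\ A f = g) <->
    ((t^-1)%:C%C *: (U t f - f) @[t --> (0 : R)^'] --> g).

(* U t = exp (t A): for a skew-adjoint A, the unitary group with generator A is
   unique. *)
Definition is_exponential (H : hilbertType) (A : operator H)
    (U : R -> H -> H) :=
  unitary_group U /\ is_generator U A.

End hilbert.

Section L2.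
Variables (R : realType) (d : measure_display) (T : measurableType d).
Variable mu : {measure set T -> \bar R}.
Local Notation C := R[i].

Definition cmeasurable (f : T -> C) :=
  measurable_fun setT (fun x => complex.Re (f x)) /\
  measurable_fun setT (fun x => complex.Im (f x)).

Definition cintegral (f : T -> C) : C :=
  ((\int[mu]_x complex.Re (f x)) +i* (\int[mu]_x complex.Im (f x)))%C.

Definition square_integrable (f : T -> C) :=
  cmeasurable f /\ mu.-integrable setT
    (fun x => (complex.Re (f x) ^+ 2 + complex.Im (f x) ^+ 2)%:E).

(* The complex L^2(mu): a Hilbert space with a map [cls] from functions to
   classes, specified on square-integrable functions.  These properties
   determine it up to a unique unitary isomorphism. *)
Record L2space := L2Space {
  L2hilb :> hilbertType R ;
  cls : (T -> C) -> L2hilb ;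
  cls_linear : forall (a : C) f g,
    square_integrable f -> square_integrable g ->
    cls (fun x => a * f x + g x) = a *: cls f + cls g ;
  cls_dot : forall f g, square_integrable f -> square_integrable g ->
    hdot (cls f) (cls g) = cintegral (fun x => (f x)^* * g x) ;
  cls_surj : forall h, exists2 f, square_integrable f & cls f = h }.

Definition L2_ge0 (H : L2space) (h : H) :=
  exists f, [/\ square_integrable f, forall x, 0 <= f x & cls H f = h].

Definition commutes_with_conj (H : L2space) (A : operator H) :=
  forall f g, square_integrable f -> square_integrable g ->
    dom A (cls H f) -> A (cls H f) = cls H g ->
    dom A (cls H (fun x => (f x)^*)) /\
    A (cls H (fun x => (f x)^*)) = cls H (fun x => (g x)^*).

Definition is_weak_integral (H : hilbertType R) (F : T -> H) (u : T -> C)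
    (v : H) :=
  forall psi, hdot psi v = cintegral (fun y => hdot psi (F y) * u y).

End L2.

Section dynamics.
Variables (R : realType) (X : ptopologicalType).

Definition metrizable := exists dist : X -> X -> R,
  [/\ forall x y, 0 <= dist x y, forall x y, dist x y = 0 <-> x = y,
      forall x y, dist x y = dist y x,
      forall x y z, dist x z <= dist x y + dist y z &
      forall x (A : set X), nbhs x A <->
        exists2 e, 0 < e & [set y | dist x y < e] `<=` A].

Definition borel := g_sigma_algebraType (@open X).

Variable mu : probability borel R.

Definition is_flow (Phi : R -> X -> X) :=
  [/\ forall x, Phi 0 x = x, forall s t x, Phi (s + t) x = Phi s (Phi t x) &
      continuous (fun p : R * X => Phi p.1 p.2)].

Definition invariant_measure (Phi : R -> X -> X) :=
  forall t (A : set borel), measurable A -> mu (Phi t @^-1` A) = mu A.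

Definition ergodic (Phi : R -> X -> X) :=
  forall A : set borel, measurable A -> (forall t, Phi t @^-1` A = A) ->
    mu A = 0%E \/ mu A = 1%E.

Definition is_support (S : set X) :=
  [/\ closed S, mu S = 1%E &
      forall F : set X, closed F -> mu F = 1%E -> S `<=` F].

End dynamics.

Section manifold.
Variable R : realType.

(* O is open and V finite-dimensional in all uses, so that continuity of all the
   directional derivatives amounts to continuity of the differential. *)
Definition C1_on (V W : normedModType R) (O : set V) (f : V -> W) :=
  (forall x, O x -> differentiable f x) /\
  forall x v, O x -> {for x, continuous (fun y => 'd f y v)}.

Variables (X : topologicalType) (d : nat).

Record chart := Chart {
  cdom : set X ; cmap : X -> 'rV[R]_d ; cinv : 'rV[R]_d -> X }.

Definition cimg (c : chart) : set 'rV[R]_d := cmap c @` cdom c.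

Variables (I : Type) (c : I -> chart).

(* The charts form a C^1 atlas on the subspace M of X *)
Definition C1_atlas (M : set X) :=
  [/\ M = \bigcup_i cdom (c i),
      forall i, exists2 O, open O & cdom (c i) = M `&` O,
      forall i, [/\ open (cimg (c i)),
        forall x, cdom (c i) x -> cinv (c i) (cmap (c i) x) = x,
        {within cdom (c i), continuous (cmap (c i))} &
        {within cimg (c i), continuous (cinv (c i))}] &
      forall i j, C1_on (cmap (c i) @` (cdom (c i) `&` cdom (c j)))
                        (cmap (c j) \o cinv (c i))].

Definition C1_function (f : X -> R[i]) := forall i,
  C1_on (cimg (c i)) (fun u => complex.Re (f (cinv (c i) u))) /\
  C1_on (cimg (c i)) (fun u => complex.Im (f (cinv (c i) u))).

Definition C1_kernel (k : X -> X -> R) := forall i j,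
  C1_on (cimg (c i) `*` cimg (c j))
    (fun p : 'rV[R]_d * 'rV[R]_d => k (cinv (c i) p.1) (cinv (c j) p.2)).

(* v i x is the representative in chart i of the vector at x *)
Definition vector_field (v : I -> X -> 'rV[R]_d) :=
  (forall i, {within cdom (c i), continuous (v i)}) /\
  forall i j x, cdom (c i) x -> cdom (c j) x ->
    v j x = 'd (cmap (c j) \o cinv (c i)) (cmap (c i) x) (v i x).

(* g = v . grad f on the manifold *)
Definition is_directional_derivative (v : I -> X -> 'rV[R]_d)
    (f g : X -> R[i]) := forall i x, cdom (c i) x ->
  g x =
    ('d (fun u => complex.Re (f (cinv (c i) u))) (cmap (c i) x) (v i x) +i*
     'd (fun u => complex.Im (f (cinv (c i) u))) (cmap (c i) x) (v i x))%C.

End manifold.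

Section koopman.
Variables (R : realType) (X : ptopologicalType).
Variables (mu : probability (borel X) R) (H : L2space mu).
Local Notation C := R[i].

(* The map C(M) -> H; elements of C(M) are represented by functions on X, whose
   values outside M are irrelevant. *)
Definition iotaM (M : set X) (f : X -> C) : H := cls H (patch (fun=> 0) M f).

Definition koopman (Phi : R -> X -> X) (U : R -> H -> H) :=
  forall t f, square_integrable mu f -> U t (cls H f) = cls H (f \o Phi t).

Definition generated_by_vector_field (d : nat) (I : Type)
    (c : I -> chart R X d) (v : I -> X -> 'rV[R]_d) (M : set X)
    (V : operator H) :=
  forall f g, C1_function c f -> is_directional_derivative c v f g ->
    dom V (iotaM M f) /\ V (iotaM M f) = iotaM M g.

End koopman.

Section rkhs.
Variables (R : realType) (X : Type).
Local Notation C := R[i].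

(* The RKHS of k: a Hilbert space of functions on X (via the injective linear
   map [rk_eval]) that contains the sections k(x, .) and in which they
   reproduce point evaluation. *)
Record rkhs (k : X -> X -> R) := RKHS {
  rk_hilb :> hilbertType R ;
  rk_eval : rk_hilb -> X -> C ;
  rk_linear : forall (a : C) f g x,
    rk_eval (a *: f + g) x = a * rk_eval f x + rk_eval g x ;
  rk_inj : injective rk_eval ;
  rk_section : X -> rk_hilb ;
  rk_sectionE : forall x y, rk_eval (rk_section x) y = (k x y)%:C%C ;
  rk_reproducing : forall x f, rk_eval f x = hdot (rk_section x) f }.

Definition rk_sub (k : X -> X -> R) (Hk : rkhs k) (S : set X) : set Hk :=
  closed_span (@rk_section k Hk @` S).

(* The inclusion of RKHSs as spaces of functions; meaningful when every
   function of the first space belongs to the second one. *)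
Definition rk_incl (k k' : X -> X -> R) (Hk : rkhs k) (Hk' : rkhs k') (h : Hk)
    : Hk' :=
  xget 0 [set g | rk_eval g = rk_eval h].

Definition rk_varpi (k : X -> X -> R) (Hk : rkhs k) : R :=
  sup (range (fun x => hnorm (rk_section Hk x))).

Definition bounded_kernel (k : X -> X -> R) :=
  exists B, forall x y, k x y <= B.

Definition strictly_positive_definite (k : X -> X -> R) :=
  forall n (x : 'I_n -> X) (a : 'I_n -> C), injective x ->
    (exists i, a i != 0) ->
    0 < \sum_(i < n) \sum_(j < n) (a i)^* * a j * (k (x i) (x j))%:C%C.

End rkhs.

Definition continuous_kernel (R : realType) (X : topologicalType)
    (k : X -> X -> R) := continuous (fun p : X * X => k p.1 p.2).

Arguments rk_sub {R X k} Hk S.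
Arguments rk_eval {R X k} r _ _.
Arguments rk_incl {R X k k'} Hk Hk' h.

Section kernel_operators.
Variables (R : realType) (X : ptopologicalType).
Variables (mu : probability (borel X) R) (H : L2space mu).
Local Notation C := R[i].

Definition is_integral_operator (k : X -> X -> R) (Hk : rkhs k)
    (K : H -> Hk) :=
  forall f, square_integrable mu f -> forall x,
    rk_eval Hk (K (cls H f)) x = cintegral mu (fun y => (k x y)%:C%C * f y).

Definition rk_class (k : X -> X -> R) (Hk : rkhs k) (h : Hk) : H :=
  cls H (rk_eval Hk h).

Variables (k : R -> X -> X -> R) (Hk : forall tau, rkhs (k tau)).
Variable K : forall tau, H -> Hk tau.

Definition Gop (tau : R) (f : H) : H :=
  if tau == 0 then f else rk_class (K tau f).

Definition regularized_generator_rkhs (tau : R) (T : H -> Hk tau)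
    (Tadj : Hk tau -> H) (V : operator H) : operator (Hk tau) :=
  @Operator R (Hk tau)
    [set h | exists u r, [/\ dom V u, Tadj r = 0 & h = T u + r]]
    (fun h => T (V (Tadj h))).

End kernel_operators.

Section fock.
Variable R : realType.
Local Notation C := R[i].

Definition fock_weight (w : nat -> R) :=
  [/\ forall n, 0 < w n, w 0%N = 1, cvgn (series (fun n => w n ^- 2)) &
      exists B, forall n,
        \sum_(i < n.+1) w i ^- 2 * w (n - i)%N ^- 2 <= B * w n ^- 2].

Variables (w : nat -> R) (H : hilbertType R).

(* The weighted symmetric Fock space F_w(H): [vee f] is f_1 v ... v f_n, with
   the empty tensor 1 : C in degree 0; being complete and spanned by the [vee f],
   the space is the completion of the symmetric tensors. *)
Record fock_space := FockSpace {
  fock_hilb :> hilbertType R ;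
  vee : forall n, ('I_n -> H) -> fock_hilb ;
  vee_dot : forall n (f g : 'I_n -> H), hdot (vee f) (vee g) =
    (w n ^+ 2 / (n`!)%:R ^+ 2)%:C%C *
    \sum_(s : 'S_n) \sum_(s' : 'S_n) \prod_(i < n) hdot (f (s i)) (g (s' i)) ;
  vee_orth : forall n m (f : 'I_n -> H) (g : 'I_m -> H), n != m ->
    hdot (vee f) (vee g) = 0 ;
  vee_total :
    closed_span [set h | exists n (f : 'I_n -> H), h = vee f] = setT }.

Definition fcat n m (f : 'I_n -> H) (g : 'I_m -> H) (i : 'I_(n + m)) : H :=
  match fintype.split i with inl j => f j | inr j => g j end.

Record fock_algebra := FockAlgebra {
  fock :> fock_space ;
  fmul : fock -> fock -> fock ;
  fmul_linearl : forall b, is_linear (fmul^~ b) ;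
  fmul_linearr : forall a, is_linear (fmul a) ;
  fmul_bounded : exists B : C, forall a b, `|fmul a b| <= B * `|a| * `|b| ;
  fmul_vee : forall n m (f : 'I_n -> H) (g : 'I_m -> H),
    fmul (vee fock f) (vee fock g) = vee fock (fcat f g) }.

Definition vpow (F : fock_space) (n : nat) (f : H) : F :=
  vee F (fun _ : 'I_n => f).

Section spectrum.
Variable F : fock_algebra.

Record spectrum := Spectrum {
  character :> F -> C ;
  character_linear : forall (a : C) x y,
    character (a *: x + y) = a * character x + character y ;
  character_mul : forall x y,
    character (fmul x y) = character x * character y ;
  character_neq0 : exists x, character x != 0 }.

HB.instance Definition _ := gen_eqMixin spectrum.
HB.instance Definition _ := gen_choiceMixin spectrum.

(* the weak-* topology *)
HB.instance Definition _ := Topological.copy spectrum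
  (initial_topology (character : spectrum -> {ptws F -> C})).

Definition gelfand (f : F) : spectrum -> C := fun chi => chi f.

Lemma gelfand_continuous (f : F) : continuous (gelfand f).
Proof.
move=> chi; apply: (@continuous_comp _ _ _
  (character : spectrum -> {ptws F -> C}) (fun g : {ptws F -> C} => g f)).
  exact: initial_continuous.
exact: proj_continuous.
Qed.

End spectrum.
End fock.

(* The bounded operator J between Fock spaces induced by A:
   J (f_1 v ... v f_n) = A f_1 v ... v A f_n, identity in degree 0. *)
Definition fock_lift (R : realType) (w : nat -> R) (H1 H2 : hilbertType R)
    (F1 : fock_space w H1) (F2 : fock_space w H2)
    (A : H1 -> H2) (J : F1 -> F2) :=
  [/\ is_linear J, continuous J &
      forall n (f : 'I_n -> H1), J (vee F1 f) = vee F2 (A \o f)].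

Definition fock_feature (R : realType) (w : nat -> R) (H : hilbertType R)
    (F : fock_space w H) (varpi : R) (h : H) : F :=
  lim (series (fun n => (w n ^- 2 / varpi ^+ n)%:C%C *: vpow F n h) @ \oo).

Section prediction.
Variables (R : realType) (w : nat -> R) (H : hilbertType R).
Variables (F : fock_algebra w H).
Local Notation C := R[i].

Definition is_induced_flow (J : F -> F) (flow : spectrum F -> spectrum F) :=
  forall chi a, flow chi a = chi (J a).

(* the Gelfand transform of a, composed with the flow on the spectrum *)
Definition evolved_observable (flow : spectrum F -> spectrum F) (a : F) :
    spectrum F -> C := gelfand a \o flow.

Definition prediction (X : Type) (flow : spectrum F -> spectrum F) (a b : F)
    (phi : X -> spectrum F) (x : X) : C :=
  evolved_observable flow a (phi x) / evolved_observable flow b (phi x).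

End prediction.

(* Main.v *)
(* After expanding the feature vector and moving the lifted unitary to the other
   side of the inner product, the predictor at [x] becomes a quotient of weighted
   averages [int a_x(y)^m f(y) dmu(y) / int a_x(y)^m dmu(y)] with weight
   [a_x(y) = <iota U_tau^(-t) phi_sigma(x), kappa(., y)>_H].
   As [tau -> 0] the weight converges, uniformly for [x] in the compact set [M]
   (the inclusions [H_tau -> H] are contractions), to
   [int k_sigma(x, z) kappa(Phi^t z, y) dmu(z)].  By the Markov property this is
   an average of [kappa], hence bounded and bounded away from 0 independently of
   [sigma], which makes the quotient Lipschitz in the weight.
   As a function of [x] it is [G_sigma U^t kappa(., y)], so as [sigma -> 0] it
   tends to [kappa(Phi^t x, y)] in L^2, and finitely many [y] suffice to control
   all of them.  As [m -> oo] the weights [kappa(z, y)^m] concentrate at [y = z],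
   uniformly for [z] in the support. *)
Require Import Defs.
From HB Require Import structures.
From mathcomp Require Import all_boot all_order all_algebra.
From mathcomp Require Import perm complex.
From mathcomp Require Import all_classical all_reals all_analysis.
From mathcomp Require Import sesquilinear measurable_realfun ring lra.
Set Implicit Arguments.
Unset Strict Implicit.
Unset Printing Implicit Defensive.
Import Order.TTheory GRing.Theory Num.Theory.
Import numFieldNormedType.Exports.
Local Open Scope classical_set_scope.
Local Open Scope ring_scope.

(** * Real-valued norms over the complex field *)

(** The obstacle is uniformity. The diagonal of [k tau] is not controlled as [tau] tends to 0, so
    bounding a function of [Hk tau] pointwise by its norm gives nothing in the limit. The constant 1
    for the inclusion into [H] is extracted instead from the semigroup law of [Gop] and its
    self-adjointness. With it the evolved features are Lipschitz in the kernel section, with a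
    constant free of [tau], and this equicontinuity turns convergence at each point of [M] into
    uniform convergence on [M]. For positive [tau] the weights are handled as complex numbers. A
    lower bound for the denominator is therefore first proved for the limiting weight, which is real
    and positive, and then transferred to small [tau] through the Lipschitz estimate. The
    convergence in [sigma] holds only in L^2 and for one [y] at a time, while the quotient at [x]
    needs its weight controlled for almost every [y]. The error at [x] is majorized by a finite sum
    over a net of points [y] plus a constant, where replacing [y] by a net point costs a sup-norm
    error that does not depend on [sigma]. *)

Section realnorm.
Context {R : realType} {V : normedModType R[i]}.
Implicit Types (x y z : V) (a : R[i]).

(** Norms of modules over [R[i]] take values in [R[i]]; the real part carries the same information
    in a totally ordered field. On a Hilbert space it is convertible to [hnorm]. *)
Definition rnorm (x : V) : R := complex.Re `|x|.

Lemma rnormE x : `|x| = (rnorm x)%:C%C.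
Proof. by rewrite /rnorm RRe_real // realE normr_ge0. Qed.

Lemma rnorm_ge0 x : 0 <= rnorm x.
Proof. by rewrite -lecR -rnormE normr_ge0. Qed.

Lemma rnorm0 : rnorm (0 : V) = 0.
Proof. by rewrite /rnorm normr0. Qed.

Lemma rnorm_eq0 x : (rnorm x == 0) = (x == 0).
Proof. by rewrite -[RHS]normr_eq0 rnormE eq_complex /= eqxx andbT. Qed.

Lemma rnorm_neq0 (c : R) x : 0 < c -> c <= rnorm x -> x != 0.
Proof. by move=> c0 cx; rewrite -rnorm_eq0 gt_eqF // (lt_le_trans c0). Qed.

Lemma rnormN x : rnorm (- x) = rnorm x.
Proof. by rewrite /rnorm normrN. Qed.

Lemma rdistC x y : rnorm (x - y) = rnorm (y - x).
Proof. by rewrite /rnorm distrC. Qed.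

Lemma rnormD x y : rnorm (x + y) <= rnorm x + rnorm y.
Proof. by rewrite -lecR rmorphD /= -!rnormE ler_normD. Qed.

Lemma rdistD z x y : rnorm (x - y) <= rnorm (x - z) + rnorm (z - y).
Proof. by have := rnormD (x - z) (z - y); rewrite addrA subrK. Qed.

Lemma rnormB_le x y : `|rnorm x - rnorm y| <= rnorm (x - y).
Proof.
have := rnormD (x - y) y; have := rnormD (y - x) x.
by rewrite !subrK (rdistC y x) ler_norml => *; lra.
Qed.

End realnorm.

Section realnorm_scale.
Context {R : realType} {V : normedModType R[i]}.
Implicit Types (x y z : V) (a b : R[i]).

Lemma rnormZ a x : rnorm (a *: x) = rnorm a * rnorm x.
Proof. by apply: complexI; rewrite rmorphM /= -!rnormE normrZ. Qed.

Lemma rnormM a b : rnorm (a * b) = rnorm a * rnorm b.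
Proof. by apply: complexI; rewrite rmorphM /= -!rnormE normrM. Qed.

Lemma rnormV a : rnorm a^-1 = (rnorm a)^-1.
Proof. by apply: complexI; rewrite fmorphV /= -!rnormE normfV. Qed.

Lemma rnormX a n : rnorm (a ^+ n) = rnorm a ^+ n.
Proof. by apply: complexI; rewrite rmorphXn /= -!rnormE normrX. Qed.

Lemma rnormR (r : R) : rnorm (r%:C%C : R[i]) = `|r|.
Proof. by rewrite /rnorm normc_def /= expr0n /= addr0 sqrtr_sqr. Qed.

Lemma rnorm1 : rnorm (1 : R[i]) = 1.
Proof. by rewrite /rnorm normr1. Qed.

Lemma rnorm_sqr a : rnorm a ^+ 2 = complex.Re a ^+ 2 + complex.Im a ^+ 2.
Proof. by apply: complexI; rewrite add_Re2_Im2 rmorphXn /= -rnormE. Qed.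

Lemma conj_realC (r : R) : (r%:C%C : R[i])^* = r%:C%C.
Proof. exact: conjc_real. Qed.

Lemma rnormJ a : rnorm (a^*) = rnorm a.
Proof. by rewrite /rnorm norm_conjC. Qed.

Lemma Re_le_rnorm a : `|complex.Re a| <= rnorm a.
Proof. by rewrite -lecR -rnormE normc_ge_Re. Qed.

Lemma Im_le_rnorm a : `|complex.Im a| <= rnorm a.
Proof.
rewrite -(@ler_pXn2r _ 2) ?nnegrE ?rnorm_ge0 //.
by rewrite rnorm_sqr real_normK ?num_real // lerDr sqr_ge0.
Qed.

Lemma rnorm_le a : rnorm a <= `|complex.Re a| + `|complex.Im a|.
Proof.
rewrite -(@ler_pXn2r _ 2) ?nnegrE ?addr_ge0 ?rnorm_ge0 //.
rewrite rnorm_sqr -[X in X + _]real_normK ?num_real //.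
rewrite -[X in _ + X]real_normK ?num_real //.
by rewrite sqrrD lerD2r lerDl mulrn_wge0 // mulr_ge0.
Qed.

End realnorm_scale.

Section realnorm_topology.
Context {R : realType} {V : normedModType R[i]}.

(** A positive element of [R[i]] is real, so balls of real radius form a neighbourhood basis. *)
Lemma nbhs_rnormP (x : V) (A : set V) :
  nbhs x A <-> exists2 e : R, 0 < e & forall y, rnorm (x - y) < e -> A y.
Proof.
split.
  move/nbhs_normP => [e /= e0 xA].
  have eE : e = (complex.Re e)%:C%C by rewrite RRe_real // realE (ltW e0).
  exists (complex.Re e); first by rewrite -ltcR -eE.
  by move=> y xy; apply: xA => /=; rewrite eE rnormE ltcR.
move=> [e e0 xA]; apply/nbhs_normP; exists e%:C%C => /=; first by rewrite ltcR.
by move=> y /=; rewrite rnormE ltcR; exact: xA.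
Qed.

Lemma cvg_rnormP T (F : set_system T) (FF : Filter F) (f : T -> V) (l : V) :
  f @ F --> l <-> forall e : R, 0 < e -> \forall t \near F, rnorm (l - f t) < e.
Proof.
split=> [fl e e0|fl A /nbhs_rnormP[e e0 lA]].
  by apply: (fl [set y | rnorm (l - y) < e]); apply/nbhs_rnormP; exists e.
by have := fl _ e0; apply: filterS => t; exact: lA.
Qed.

Lemma cvg_rnorm0P T (F : set_system T) (FF : Filter F) (f : T -> V) (l : V) :
  f @ F --> l <-> rnorm (l - f t) @[t --> F] --> (0 : R).
Proof.
rewrite cvg_rnormP; split=> [fl|/cvgrPdist_lt fl e e0].
  apply/cvgrPdist_lt => e e0; have := fl _ e0; apply: filterS => t.
  by rewrite sub0r normrN ger0_norm ?rnorm_ge0.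
have := fl _ e0; apply: filterS => t.
by rewrite sub0r normrN ger0_norm ?rnorm_ge0.
Qed.

Lemma lipschitz1_continuous (g : V -> R) :
  (forall x y, `|g x - g y| <= rnorm (x - y)) -> continuous g.
Proof.
move=> g1 x; apply/cvgrPdist_lt => e e0; apply/nbhs_rnormP; exists e => // y xy.
exact: le_lt_trans (g1 _ _) xy.
Qed.

Lemma rnorm_continuous : continuous (@rnorm R V).
Proof. by apply: lipschitz1_continuous => x y; exact: rnormB_le. Qed.

Lemma cvgn_near_eq (u : nat -> V) (l a : V) :
  u @ \oo --> l -> (\forall n \near \oo, u n = a) -> l = a.
Proof.
move=> ul ua; apply: norm_cvg_unique ul _; exact: cvg_near_cst.
Qed.

End realnorm_topology.

(** * Inner products, linear maps and unitary groups *)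

Section hilbert_theory.
Context {R : realType} {H : hilbertType R}.
Implicit Types (x y z : H) (a : R[i]).

Lemma hdotDr x y z : hdot x (y + z) = hdot x y + hdot x z.
Proof. exact: linearDl. Qed.

Lemma hdotDl x y z : hdot (x + y) z = hdot x z + hdot y z.
Proof. exact: linearDr. Qed.

Lemma hdotZr a x y : hdot x (a *: y) = a * hdot x y.
Proof. exact: linearZl_LR. Qed.

Lemma hdotZl a x y : hdot (a *: x) y = a^* * hdot x y.
Proof. exact: linearZr_LR. Qed.

Lemma hdotNr x y : hdot x (- y) = - hdot x y.
Proof. exact: linearNl. Qed.

Lemma hdotNl x y : hdot (- x) y = - hdot x y.
Proof. exact: linearNr. Qed.

Lemma hdotBr x y z : hdot x (y - z) = hdot x y - hdot x z.
Proof. by rewrite hdotDr hdotNr. Qed.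

Lemma hdotBl x y z : hdot (x - y) z = hdot x z - hdot y z.
Proof. by rewrite hdotDl hdotNl. Qed.

Lemma hdot0r x : hdot x 0 = 0.
Proof. exact: linear0l. Qed.

Lemma hdot0l x : hdot 0 x = 0.
Proof. exact: linear0r. Qed.

Lemma hdot_sumr (J : Type) (r : seq J) (P : pred J) (f : J -> H) x :
  hdot x (\sum_(j <- r | P j) f j) = \sum_(j <- r | P j) hdot x (f j).
Proof. by elim/big_rec2: _ => [|j u v _ <-]; rewrite ?hdot0r ?hdotDr. Qed.

Lemma hdot_suml (J : Type) (r : seq J) (P : pred J) (f : J -> H) x :
  hdot (\sum_(j <- r | P j) f j) x = \sum_(j <- r | P j) hdot (f j) x.
Proof. by elim/big_rec2: _ => [|j u v _ <-]; rewrite ?hdot0l ?hdotDl. Qed.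

Lemma hdotC x y : hdot x y = (hdot y x)^*.
Proof. by rewrite /hdot hermC expr0 mul1r. Qed.

Lemma hdot_rnorm x : hdot x x = (rnorm x ^+ 2)%:C%C.
Proof. by rewrite /hdot hform_norm rnormE rmorphXn. Qed.

(** Cauchy-Schwarz, from the nonnegativity of a single squared norm. *)
Lemma rnorm_hdot x y : rnorm (hdot x y) <= rnorm x * rnorm y.
Proof.
have [->|y0] := eqVneq y 0; first by rewrite hdot0r !rnorm0 mulr0.
have y0' : 0 < rnorm y by rewrite lt_neqAle eq_sym rnorm_eq0 y0 rnorm_ge0.
(* [Y *: x - c *: y] is [Y] times the component of [x] orthogonal to [y]; scaling by [Y] avoids a
   division. *)
set Y := hdot y y; pose c := hdot y x.
have YE : Y = (rnorm y ^+ 2)%:C%C by exact: hdot_rnorm.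
have zE : hdot (Y *: x - c *: y) (Y *: x - c *: y) =
    Y * (Y * hdot x x - c * c^*).
  rewrite hdotBl !hdotBr !hdotZl !hdotZr -/Y (hdotC x y) -/c.
  have -> : Y^* = Y by rewrite -hdotC.
  by ring.
move: zE; rewrite !hdot_rnorm YE -normCK rnormE -!rmorphXn -!rmorphM -rmorphB.
rewrite -rmorphM => /complexI zE.
have := sqr_ge0 (rnorm (((rnorm y ^+ 2)%:C)%C *: x - c *: y)).
rewrite zE pmulr_rge0 ?exprn_gt0 // subr_ge0.
rewrite -exprMn ler_pXn2r ?nnegrE ?mulr_ge0 ?rnorm_ge0 //.
by rewrite hdotC rnormJ mulrC.
Qed.

Lemma rnorm_sqrB x y :
  rnorm (x - y) ^+ 2 = rnorm x ^+ 2 + rnorm y ^+ 2 - 2 * complex.Re (hdot x y).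
Proof.
apply: complexI; rewrite -hdot_rnorm hdotBl !hdotBr !hdot_rnorm (hdotC y x).
have xyE : (hdot x y)^* = 2%:R * (complex.Re (hdot x y))%:C%C - hdot x y.
  by have <- : hdot x y + (hdot x y)^* = _ := addcJ (hdot x y); rewrite addrAC subrr add0r.
by rewrite xyE rmorphB rmorphD [X in _ = _ - X]rmorphM rmorph_nat; ring.
Qed.

Lemma hdot_continuousl y : continuous (fun x => hdot x y).
Proof.
move=> x; apply/cvg_rnormP => e e0; apply/nbhs_rnormP.
exists (e / (rnorm y + 1)).
  by rewrite divr_gt0 // ltr_wpDl ?rnorm_ge0.
move=> z xz; rewrite -hdotBl (le_lt_trans (rnorm_hdot _ _)) //.
apply: (@le_lt_trans _ _ (rnorm (x - z) * (rnorm y + 1))).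
  by rewrite ler_wpM2l ?rnorm_ge0 // lerDl.
by rewrite -ltr_pdivlMr // ltr_wpDl ?rnorm_ge0.
Qed.

Lemma hdot_continuousr x : continuous (fun y => hdot x y).
Proof.
move=> y; apply/cvg_rnormP => e e0; apply/nbhs_rnormP.
exists (e / (rnorm x + 1)).
  by rewrite divr_gt0 // ltr_wpDl ?rnorm_ge0.
move=> z yz; rewrite -hdotBr (le_lt_trans (rnorm_hdot _ _)) //.
apply: (@le_lt_trans _ _ ((rnorm x + 1) * rnorm (y - z))).
  by rewrite ler_wpM2r ?rnorm_ge0 // lerDl.
by rewrite mulrC -ltr_pdivlMr // ltr_wpDl ?rnorm_ge0.
Qed.

End hilbert_theory.

Section linear_maps.
Context {R : realType} {H1 H2 : hilbertType R} {A : H1 -> H2}.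
Hypothesis Alin : is_linear A.

Lemma is_linearD x y : A (x + y) = A x + A y.
Proof. by rewrite -[x]scale1r Alin !scale1r. Qed.

Lemma is_linear0 : A 0 = 0.
Proof. by apply: (addrI (A 0)); rewrite -is_linearD !addr0. Qed.

Lemma is_linearZ a x : A (a *: x) = a *: A x.
Proof. by rewrite -[a *: x]addr0 Alin is_linear0 addr0. Qed.

Lemma is_linearB x y : A (x - y) = A x - A y.
Proof. by rewrite -scaleN1r addrC Alin scaleN1r addrC. Qed.

Lemma is_linear_sum n (f : nat -> H1) :
  A (\sum_(0 <= i < n) f i) = \sum_(0 <= i < n) A (f i).
Proof.
elim: n => [|n IH]; first by rewrite !big_geq // is_linear0.
by rewrite !big_nat_recr //= is_linearD IH.
Qed.

End linear_maps.

Lemma isometry_rnorm (R : realType) (H1 H2 : hilbertType R) (A : H1 -> H2) :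
  is_isometry A -> forall x, rnorm (A x) = rnorm x.
Proof.
move=> [_ Aiso] x; have := Aiso x x; rewrite !hdot_rnorm => /complexI /eqP.
by rewrite eqrXn2 ?rnorm_ge0 // => /eqP.
Qed.

Section unitary_groups.
Context {R : realType} {H : hilbertType R} {U : R -> H -> H}.
Hypothesis U_group : unitary_group U.

(** Apply the isometry [U t] to both arguments on the left and use the group law. *)
Lemma unitaryV t (x y : H) : hdot (U (- t) x) y = hdot x (U t y).
Proof.
have [Uu U0 Us _] := U_group; have [[_ <-] _] := Uu t.
by rewrite -Us subrr U0.
Qed.

Lemma U_rnorm t x : rnorm (U t x) = rnorm x.
Proof. by have [Uu _ _ _] := U_group; have [Ui _] := Uu t; exact: isometry_rnorm. Qed.

Lemma U_rnormB t x y : rnorm (U t x - U t y) = rnorm (x - y).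
Proof.
have [Uu _ _ _] := U_group; have [[Ul _] _] := Uu t.
by rewrite -is_linearB // U_rnorm.
Qed.

End unitary_groups.

(** * Feature vectors in Fock space *)

(** By Pythagoras the squared norm of a block of the series is the same block of the series of
    squares, so one Cauchy criterion yields the other. *)
Lemma orthogonal_series_cvg (R : realType) (H : hilbertType R) (u : nat -> H) :
  (forall i j, i != j -> hdot (u i) (u j) = 0) ->
  cvgn (series (fun n => rnorm (u n) ^+ 2)) -> cvgn (series u).
Proof.
move=> u_orth u_sq.
have pyth m n : rnorm (\sum_(m <= k < n) u k) ^+ 2 =
    \sum_(m <= k < n) rnorm (u k) ^+ 2.
  apply: complexI; rewrite -hdot_rnorm hdot_suml rmorph_sum /=.
  rewrite big_nat [RHS]big_nat; apply: eq_bigr => i imn.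
  rewrite hdot_sumr (bigD1_seq i) ?iota_uniq ?mem_index_iota //= hdot_rnorm.
  by rewrite big1 ?addr0 // => j ji; rewrite u_orth // eq_sym.
apply/cauchy_cvgP/cauchy_seriesP => e e0.
have eE : e = (complex.Re e)%:C%C by rewrite RRe_real // realE (ltW e0).
move: e0; rewrite eE ltcR => e0.
move/cauchy_cvgP/cauchy_seriesP : u_sq => /(_ _ (exprn_gt0 2 e0)).
apply: filterS => -[m n] /=; rewrite -pyth ger0_norm ?sqr_ge0 // rnormE ltcR.
by rewrite ltr_pXn2r // nnegrE ?rnorm_ge0 // ltW.
Qed.

Section fock_theory.
Context {R : realType} {w : nat -> R}.

(** All pairs of permutations contribute the same product, and their number cancels the squared
    factorial in the inner product. *)
Lemma hdot_vpow (H : hilbertType R) (F : fock_space w H) n (f g : H) :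
  hdot (vpow F n f) (vpow F n g) = (w n ^+ 2)%:C%C * hdot f g ^+ n.
Proof.
rewrite /vpow vee_dot.
under eq_bigr do under eq_bigr do rewrite prodr_const card_ord.
rewrite !sumr_const card_Sn -!mulrnA -[X in _ * X]mulr_natl mulrA.
congr (_ * _).
rewrite -(rmorph_nat (real_complex R)) -rmorphM natrM -expr2 divfK //.
Qed.

Lemma hdot_vpow_neq (H : hilbertType R) (F : fock_space w H) n m (f g : H) :
  n != m -> hdot (vpow F n f) (vpow F m g) = 0.
Proof. exact: vee_orth. Qed.

Hypothesis w_weight : fock_weight w.

(** The terms are orthogonal, and the [n]-th one has squared norm
    [w n ^- 2 * (rnorm h / c) ^+ (2 * n)], which is dominated by the summable [w n ^- 2]. *)
Lemma fock_feature_cvg (H : hilbertType R) (F : fock_space w H) (c : R) (h : H) :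
  0 < c -> rnorm h <= c ->
  cvgn (series (fun n => (w n ^- 2 / c ^+ n)%:C%C *: vpow F n h)).
Proof.
case: w_weight => w_gt0 w0 w_cvg _ c0 hc; apply: orthogonal_series_cvg.
  by move=> i j ij; rewrite hdotZl hdotZr hdot_vpow_neq // !mulr0.
apply: series_le_cvg w_cvg => n.
- exact: sqr_ge0.
- by rewrite invr_ge0 exprn_ge0 // ltW.
have vE : rnorm (vpow F n h) = w n * rnorm h ^+ n.
  apply/eqP; rewrite -(@eqrXn2 _ 2) ?rnorm_ge0 ?mulr_ge0 ?exprn_ge0 ?(ltW (w_gt0 _)) ?rnorm_ge0 //.
  apply/eqP/complexI; rewrite -hdot_rnorm hdot_vpow hdot_rnorm.
  by rewrite -rmorphXn -rmorphM exprMn -expr2 -exprMn.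
rewrite rnormZ rnormR vE ger0_norm; last first.
  by rewrite divr_ge0 ?invr_ge0 ?exprn_ge0 ?ltW.
have -> : w n ^- 2 / c ^+ n * (w n * rnorm h ^+ n) = (w n)^-1 * (rnorm h / c) ^+ n.
  rewrite expr_div_n; field.
  by apply/andP; split; [exact/expf_neq0/lt0r_neq0|exact/lt0r_neq0].
have le1 : ((rnorm h / c) ^+ n) ^+ 2 <= 1.
  rewrite -exprM; apply: exprn_ile1; first by rewrite divr_ge0 ?rnorm_ge0 ?ltW.
  by rewrite ler_pdivrMr ?mul1r.
by rewrite exprMn exprVn ler_piMr // invr_ge0 exprn_ge0 // ltW.
Qed.

(** Continuity of [J] allows pairing term by term. Distinct degrees are orthogonal, so only degree
    [m] survives, where [w m ^- 2] cancels the weight of the inner product and [c ^- m] remains. *)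
Lemma hdot_lift_fock_feature (H1 H2 : hilbertType R) (F1 : fock_space w H1)
    (F2 : fock_space w H2) (A : H1 -> H2) (J : F1 -> F2) (c : R) (h : H1)
    (m : nat) (g : H2) :
  fock_lift A J -> 0 < c -> rnorm h <= c ->
  hdot (J (fock_feature F1 c h)) (vpow F2 m g) = ((c^-1)%:C%C * hdot (A h) g) ^+ m.
Proof.
move=> [Jlin Jcont Jvee] c0 hc; case: (w_weight) => w_gt0 _ _ _.
set u := fun n => (w n ^- 2 / c ^+ n)%:C%C *: vpow F1 n h.
have u_cvg : series u @ \oo --> fock_feature F1 c h.
  exact: fock_feature_cvg.
have dot_cvg : hdot (J (series u n)) (vpow F2 m g) @[n --> \oo] -->
    hdot (J (fock_feature F1 c h)) (vpow F2 m g).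
  have cont : continuous (fun x => hdot (J x) (vpow F2 m g)).
    by move=> x; apply: continuous_comp; [exact: Jcont|exact: hdot_continuousl].
  exact: cvg_comp u_cvg (cont _).
(* [series u n] sums the indices below [n], so the term of degree [m] is present from [n = m.+1] on
   and the pairing is constant from there. *)
apply: cvgn_near_eq dot_cvg _; exists m.+1 => // n /= mn.
rewrite /series is_linear_sum // hdot_suml.
rewrite (bigD1_seq m) ?iota_uniq ?mem_index_iota //= big1 ?addr0; last first.
  move=> i im; rewrite is_linearZ // hdotZl /vpow Jvee.
  by rewrite hdot_vpow_neq // mulr0.
rewrite is_linearZ // hdotZl /vpow Jvee -/(vpow _ _ _) (hdot_vpow F2) mulrA.
rewrite exprMn; congr (_ * _).
rewrite conj_realC -rmorphM -rmorphXn; congr (_ _)%C.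
by rewrite exprVn mulrAC mulVf ?mul1r // expf_neq0 // lt0r_neq0.
Qed.

End fock_theory.

(** * Square-integrable functions *)

Section L2_theory.
Context {R : realType} {d : measure_display} {T : measurableType d}.
Context {mu : probability T R}.
Implicit Types f g : T -> R[i].

Lemma ae_sub (P Q : T -> Prop) : (forall x, P x -> Q x) ->
  {ae mu, forall x, P x} -> {ae mu, forall x, Q x}.
Proof. by move=> PQ; apply: filterS. Qed.

Lemma ae_and (P Q : T -> Prop) : {ae mu, forall x, P x} ->
  {ae mu, forall x, Q x} -> {ae mu, forall x, P x /\ Q x}.
Proof. by move=> aP aQ; apply: filterS2 aP aQ => x. Qed.

Lemma ae_all (P : T -> Prop) : (forall x, P x) -> {ae mu, forall x, P x}.
Proof. exact: aeW. Qed.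

Lemma cmeasurable_cst (a : R[i]) : cmeasurable (fun _ : T => a).
Proof. by split; exact: measurable_cst. Qed.

Lemma cmeasurableD f g :
  cmeasurable f -> cmeasurable g -> cmeasurable (fun x => f x + g x).
Proof.
move=> [f1 f2] [g1 g2]; split.
  rewrite (_ : (fun _ => _) = (fun x => complex.Re (f x)) \+ (fun x => complex.Re (g x))).
    exact: measurable_funD.
  by apply/funext => x /=; case: (f x) (g x) => ? ? [].
rewrite (_ : (fun _ => _) = (fun x => complex.Im (f x)) \+ (fun x => complex.Im (g x))).
  exact: measurable_funD.
by apply/funext => x /=; case: (f x) (g x) => ? ? [].
Qed.

Lemma cmeasurableM f g :
  cmeasurable f -> cmeasurable g -> cmeasurable (fun x => f x * g x).
Proof.
move=> [f1 f2] [g1 g2]; split.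
  rewrite (_ : (fun _ => _) = (fun x => complex.Re (f x)) \* (fun x => complex.Re (g x))
      \- (fun x => complex.Im (f x)) \* (fun x => complex.Im (g x))).
    by apply: measurable_funB; exact: measurable_funM.
  by apply/funext => x /=; case: (f x) (g x) => ? ? [].
rewrite (_ : (fun _ => _) = (fun x => complex.Re (f x)) \* (fun x => complex.Im (g x))
      \+ (fun x => complex.Im (f x)) \* (fun x => complex.Re (g x))).
  by apply: measurable_funD; exact: measurable_funM.
by apply/funext => x /=; case: (f x) (g x) => ? ? [].
Qed.

Lemma cmeasurableX f n : cmeasurable f -> cmeasurable (fun x => f x ^+ n).
Proof.
move=> mf; elim: n => [|n IH].
  by rewrite (_ : (fun _ => _) = cst 1) //; exact: cmeasurable_cst.
rewrite (_ : (fun _ => _) = (fun x => f x * f x ^+ n)); first exact: cmeasurableM.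
by apply/funext => x; rewrite exprS.
Qed.

Lemma cmeasurableR (g : T -> R) :
  measurable_fun setT g -> cmeasurable (fun x => (g x)%:C%C).
Proof. by split => //=; exact: measurable_cst. Qed.

Lemma measurable_rnorm_sqr f :
  cmeasurable f -> measurable_fun setT (fun x => rnorm (f x) ^+ 2).
Proof.
move=> [f1 f2]; under eq_fun do rewrite rnorm_sqr.
by apply: measurable_funD; exact: measurable_funX.
Qed.

Lemma square_integrableP f : square_integrable mu f <->
  cmeasurable f /\ mu.-integrable setT (EFin \o (fun x => rnorm (f x) ^+ 2)).
Proof.
rewrite /square_integrable.
by under [X in _ <-> _ /\ mu.-integrable setT X]eq_fun do rewrite /= rnorm_sqr.
Qed.

Lemma bounded_integrable (g : T -> R) (B : R) :
  measurable_fun setT g -> (forall x, `|g x| <= B) ->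
  mu.-integrable setT (EFin \o g).
Proof.
move=> mg gB; apply: measurable_bounded_integrable => //.
  by apply: le_lt_trans (probability_le1 mu measurableT) _; rewrite ltry.
exists B; split => [|x Bx y _]; first exact: num_real.
exact: le_trans (gB y) (ltW Bx).
Qed.

Lemma bounded_square_integrable f (B : R) :
  cmeasurable f -> (forall x, rnorm (f x) <= B) -> square_integrable mu f.
Proof.
move=> mf fB; apply/square_integrableP; split => //.
apply: (@bounded_integrable _ (B ^+ 2)); first exact: measurable_rnorm_sqr.
move=> x; rewrite ger0_norm ?sqr_ge0 // ler_pXn2r // nnegrE ?rnorm_ge0 //.
exact: le_trans (rnorm_ge0 _) (fB x).
Qed.

Lemma square_integrable_cst a : square_integrable mu (fun=> a).
Proof. exact: (bounded_square_integrable (cmeasurable_cst a)). Qed.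

Context {H : L2space mu}.

Lemma rnorm_cls f : square_integrable mu f ->
  rnorm (cls H f) ^+ 2 = \int[mu]_x (rnorm (f x) ^+ 2).
Proof.
move=> sf; apply: complexI; rewrite -hdot_rnorm cls_dot // /cintegral.
apply/eqP; rewrite eq_complex /=; apply/andP; split; apply/eqP.
  apply: eq_Rintegral => x _; rewrite rnorm_sqr.
  by case: (f x) => a b /=; rewrite -!expr2 mulNr opprK.
rewrite (_ : (fun _ => _) = cst 0) ?Rintegral_cst ?mul0r //.
by apply/funext => x; case: (f x) => a b /=; rewrite mulNr mulrC subrr.
Qed.

Lemma rnorm_cls_le f g : square_integrable mu f -> square_integrable mu g ->
  {ae mu, forall x, rnorm (f x) <= rnorm (g x)} ->
  rnorm (cls H f) <= rnorm (cls H g).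
Proof.
move=> sf sg fg.
rewrite -(@ler_pXn2r _ 2) ?nnegrE ?rnorm_ge0 // !rnorm_cls //.
case/square_integrableP : sf => mf sf; case/square_integrableP : sg => mg sg.
rewrite /Rintegral fine_le //; try exact: integrable_fin_num.
apply: ae_ge0_le_integral => //.
- by move=> x _; rewrite lee_fin sqr_ge0.
- exact/measurable_EFinP/measurable_rnorm_sqr.
- by move=> x _; rewrite lee_fin sqr_ge0.
- exact/measurable_EFinP/measurable_rnorm_sqr.
apply: filterS fg => x + _; rewrite lee_fin => fgx.
by rewrite ler_pXn2r // nnegrE rnorm_ge0.
Qed.

Lemma rnorm_cls_cst (B : R) : 0 <= B -> rnorm (cls H (fun=> B%:C%C)) = B.
Proof.
move=> B0; apply/eqP; rewrite -(@eqrXn2 _ 2) ?rnorm_ge0 //.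
rewrite rnorm_cls; last exact: square_integrable_cst.
rewrite Rintegral_cst // [X in _ * X](_ : _ = 1) ?mulr1; last first.
  exact: (congr1 fine (probability_setT mu)).
by rewrite rnormR ger0_norm.
Qed.

Lemma rnorm_cls_le_cst f (B : R) : square_integrable mu f -> 0 <= B ->
  {ae mu, forall x, rnorm (f x) <= B} -> rnorm (cls H f) <= B.
Proof.
move=> sf B0 fB; rewrite -[leRHS]rnorm_cls_cst //.
apply: rnorm_cls_le => //; first exact: square_integrable_cst.
by apply: filterS fB => x; rewrite rnormR ger0_norm.
Qed.

Lemma square_integrableP2 (a : R[i]) f g : square_integrable mu f ->
  square_integrable mu g -> square_integrable mu (fun x => a * f x + g x).
Proof.
move=> /square_integrableP[mf sf] /square_integrableP[mg sg].
have mfg : cmeasurable (fun x => a * f x + g x).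
  by apply: cmeasurableD => //; apply: cmeasurableM => //; exact: cmeasurable_cst.
apply/square_integrableP; split => //.
(* The majorant comes from [(p + q) ^+ 2 <= 2 * p ^+ 2 + 2 * q ^+ 2], the difference of the two
   sides being [(p - q) ^+ 2]. *)
apply: (le_integrable measurableT
  (g := EFin \o (fun x => 2 * rnorm a ^+ 2 * rnorm (f x) ^+ 2 + 2 * rnorm (g x) ^+ 2))).
- exact/measurable_EFinP/measurable_rnorm_sqr.
- move=> x _; rewrite !abse_EFin lee_fin ger0_norm ?sqr_ge0 // ger0_norm; last first.
    by apply: addr_ge0; apply: mulr_ge0; rewrite ?sqr_ge0 // mulr_ge0 ?sqr_ge0.
  have := rnormD (a * f x) (g x); rewrite rnormM => le.
  have s0 := rnorm_ge0 (a * f x + g x).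
  apply: (@le_trans _ _ ((rnorm a * rnorm (f x) + rnorm (g x)) ^+ 2)).
    by rewrite ler_pXn2r ?nnegrE //; exact: le_trans le.
  rewrite -subr_ge0 (_ : _ - _ = (rnorm a * rnorm (f x) - rnorm (g x)) ^+ 2) ?sqr_ge0 //.
  by ring.
- have := integrableD measurableT (integrableZl measurableT (2 * rnorm a ^+ 2) sf)
    (integrableZl measurableT 2 sg).
  by apply: eq_integrable => // x _; rewrite /= EFinD !EFinM.
Qed.

Lemma square_integrableB f g : square_integrable mu f ->
  square_integrable mu g -> square_integrable mu (fun x => f x - g x).
Proof.
move=> sf sg; rewrite (_ : (fun _ => _) = (fun x => -1 * g x + f x)).
  exact: square_integrableP2.
by apply/funext => x; rewrite mulN1r addrC.
Qed.

Lemma clsB f g : square_integrable mu f -> square_integrable mu g ->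
  cls H f - cls H g = cls H (fun x => f x - g x).
Proof.
move=> sf sg; rewrite (_ : (fun _ => _) = (fun x => -1 * g x + f x)).
  by rewrite cls_linear // scaleN1r addrC.
by apply/funext => x; rewrite mulN1r addrC.
Qed.

Lemma cls0 : cls H (fun=> 0) = 0.
Proof.
by apply/eqP; rewrite -rnorm_eq0 (rnorm_cls_cst (lexx 0)).
Qed.

Lemma square_integrableZ a f : square_integrable mu f ->
  square_integrable mu (fun x => a * f x).
Proof.
move=> sf; rewrite (_ : (fun _ => _) = (fun x => a * f x + 0)).
  by apply: square_integrableP2 => //; exact: square_integrable_cst.
by apply/funext => x; rewrite addr0.
Qed.

Lemma clsZ a f : square_integrable mu f ->
  a *: cls H f = cls H (fun x => a * f x).
Proof.
move=> sf; rewrite (_ : (fun _ => _) = (fun x => a * f x + 0)).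
  by rewrite cls_linear ?cls0 ?addr0 //; exact: square_integrable_cst.
by apply/funext => x; rewrite addr0.
Qed.

Lemma cls_ae f g : square_integrable mu f -> square_integrable mu g ->
  {ae mu, forall x, f x = g x} -> cls H f = cls H g.
Proof.
move=> sf sg fg; apply/eqP; rewrite -subr_eq0 -rnorm_eq0 clsB //.
rewrite eq_le rnorm_ge0 andbT; apply: rnorm_cls_le_cst => //.
  exact: square_integrableB.
by apply: filterS fg => x ->; rewrite subrr rnorm0.
Qed.

(** The constant 1 is square-integrable because [mu] is a probability. Linearity of the complex
    integral and bounds on its modulus can thus be read off from the Hilbert space, without
    splitting into real and imaginary parts. *)
Lemma cintegral_dot f : square_integrable mu f ->
  cintegral mu f = hdot (cls H (fun=> 1)) (cls H f).
Proof.
move=> sf; rewrite cls_dot //; last exact: square_integrable_cst.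
by congr cintegral; apply/funext => x; rewrite conjC1 mul1r.
Qed.

Lemma cintegral_linear (a : R[i]) f g : square_integrable mu f ->
  square_integrable mu g ->
  cintegral mu (fun x => a * f x + g x) = a * cintegral mu f + cintegral mu g.
Proof.
move=> sf sg; rewrite !cintegral_dot //; last exact: square_integrableP2.
by rewrite cls_linear // hdotDr hdotZr.
Qed.

End L2_theory.

(** * Borel sets and compactness *)

Lemma continuous_partiall (Y Z W : topologicalType) (g : Y * Z -> W) (y : Y) :
  continuous g -> continuous (fun z => g (y, z)).
Proof.
move=> cg z; have : {for z, continuous (g \o (fun z => (y, z)))}.
  apply: continuous_comp; last exact: cg.
  by apply: cvg_pair; [exact: cvg_cst|exact: cvg_id].
exact.
Qed.

Lemma continuous_partialr (Y Z W : topologicalType) (g : Y * Z -> W) (z : Z) :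
  continuous g -> continuous (fun y => g (y, z)).
Proof.
move=> cg y; have : {for y, continuous (g \o (fun y => (y, z)))}.
  apply: continuous_comp; last exact: cg.
  by apply: cvg_pair; [exact: cvg_id|exact: cvg_cst].
exact.
Qed.

Lemma continuous_swap (Y Z W : topologicalType) (g : Y * Z -> W) :
  continuous g -> continuous (fun p : Z * Y => g (p.2, p.1)).
Proof.
move=> cg p; have : {for p, continuous (g \o (fun p : Z * Y => (p.2, p.1)))}.
  apply: continuous_comp; last exact: cg.
  by apply: cvg_pair; [exact: cvg_snd|exact: cvg_fst].
exact.
Qed.

Section borel_theory.
Context {R : realType} {X : ptopologicalType}.

Lemma metrizable_hausdorff : metrizable R X -> hausdorff_space X.
Proof.
move=> [dist [d_ge0 d_eq0 dC dD dN]] p q pq; apply/d_eq0/eqP.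
rewrite eq_le d_ge0 andbT leNgt; apply/negP => dpq.
have e0 : 0 < dist p q / 2 by rewrite divr_gt0.
have ballP x : nbhs x [set y | dist x y < dist p q / 2].
  by apply/dN; exists (dist p q / 2).
have [y [/= py qy]] := pq _ _ (ballP p) (ballP q).
have := dD p y q; rewrite (dC y q); move: py qy => /=; lra.
Qed.

Lemma closed_borel (A : set X) : closed A -> measurable (A : set (borel X)).
Proof.
move=> cA; rewrite -(setCK A); apply: measurableC.
by apply: sub_sigma_algebra; exact: closed_openC.
Qed.

Lemma within_continuous_borel (M : set X) (g : X -> R) : closed M ->
  {within M, continuous g} -> measurable_fun (M : set (borel X)) (g : borel X -> R).
Proof.
move=> cM /continuousP cg; apply: (measurability _ (RGenOpens.measurableE R)).
move=> _ [_ [a [b ->] <-]].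
have /open_subspaceP[V oV VD] : open (from_subspace M g @^-1` `]a, b[%classic).
  exact/cg/interval_open.
rewrite setIC -VD; apply: measurableI; last exact: closed_borel.
exact: sub_sigma_algebra.
Qed.

Lemma Re_continuous : continuous (@complex.Re R).
Proof.
apply: (@lipschitz1_continuous R R[i]) => x y.
by apply: le_trans (Re_le_rnorm _); rewrite raddfB.
Qed.

Lemma Im_continuous : continuous (@complex.Im R).
Proof.
apply: (@lipschitz1_continuous R R[i]) => x y.
by apply: le_trans (Im_le_rnorm _); rewrite raddfB.
Qed.

Lemma patch_cmeasurable (M : set X) (f : X -> R[i]) : closed M ->
  {within M, continuous f} -> cmeasurable (patch (fun=> 0) M f : borel X -> R[i]).
Proof.
move=> cM cf; have mM := closed_borel cM; split.
  rewrite (_ : (fun _ => _) = (fun x : borel X => complex.Re (f x)) \_ M); last first.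
    by apply/funext => x /=; rewrite !patchE; case: ifPn.
  apply: (measurable_restrictT _ mM).1; apply: within_continuous_borel => // x.
  by apply: continuous_comp; [exact: cf|exact: Re_continuous].
rewrite (_ : (fun _ => _) = (fun x : borel X => complex.Im (f x)) \_ M); last first.
  by apply/funext => x /=; rewrite !patchE; case: ifPn.
apply: (measurable_restrictT _ mM).1; apply: within_continuous_borel => // x.
by apply: continuous_comp; [exact: cf|exact: Im_continuous].
Qed.

Lemma continuous_cmeasurable (f : X -> R[i]) :
  continuous f -> cmeasurable (f : borel X -> R[i]).
Proof.
move=> cf; rewrite (_ : f = patch (fun=> 0) setT f).
  by apply: patch_cmeasurable; [exact: closedT|exact: continuous_subspaceT].
by apply/funext => x; rewrite patchE in_setT.
Qed.

Lemma compact_rnorm_bounded (M : set X) (f : X -> R[i]) : compact M ->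
  {within M, continuous f} -> exists2 B : R, 0 <= B & forall x, M x -> rnorm (f x) <= B.
Proof.
move=> cM cf; have [->|/set0P M0] := eqVneq M set0; first by exists 0.
have cn : {within M, continuous (fun x => rnorm (f x))}.
  by move=> x; apply: continuous_comp; [exact: cf|exact: rnorm_continuous].
have [x _ xB] := compact_EVT_max M0 cM cn.
by exists (rnorm (f x)); rewrite ?rnorm_ge0 // => y My; apply: xB; rewrite inE.
Qed.

Lemma compact_pos_lower (M : set X) (g : X * X -> R) : compact M -> continuous g ->
  (forall p, 0 < g p) ->
  exists2 c : R, 0 < c & forall x y, M x -> M y -> c <= g (x, y).
Proof.
move=> cM cg g0; have [->|/set0P[a Ma]] := eqVneq M set0; first by exists 1.
have cMM : compact (M `*` M) by exact: compact_setX.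
have MM0 : (M `*` M) !=set0 by exists (a, a).
have [p _ pB] := compact_EVT_min MM0 cMM (continuous_subspaceT cg).
by exists (g p) => // x y Mx My; apply: pB; rewrite inE.
Qed.

(** A tube argument: around each [(x, y)] there is a box on which [g] stays within [e / 2] of
    [g x y], and compactness of [S] makes the neighbourhood of [x] independent of [y]. *)
Lemma compact_unif_near (S : set X) (g : X -> X -> R) (x : X) (e : R) :
  compact S -> continuous (fun p : X * X => g p.1 p.2) -> 0 < e ->
  \forall x' \near x, forall y, S y -> `|g x y - g x' y| < e.
Proof.
move=> /compact_near_coveringP cS cg e0.
apply: (cS _ _ (fun x' y => `|g x y - g x' y| < e)) => y Sy.
have e2 : 0 < e / 2 by rewrite divr_gt0.
have [[A B] /= [xA yB] AB] : nbhs (x, y) [set p : X * X | `|g x y - g p.1 p.2| < e / 2].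
  by have /cvgrPdist_lt := cg (x, y); apply.
exists (B, A) => //= -[y' x'] /= [By' Ax'].
have h1 := AB (x, y') (conj (nbhs_singleton xA) By').
have h2 := AB (x', y') (conj Ax' By').
move: h1 h2 => /=; rewrite !ltr_norml => /andP[? ?] /andP[? ?].
by apply/andP; split; lra.
Qed.

Lemma support_ae (mu : probability (borel X) R) (S : set X) : is_support mu S ->
  {ae mu, forall x : borel X, S x}.
Proof.
move=> [cS muS _]; exists (~` S : set (borel X)); split => //.
  by apply: measurableC; exact: closed_borel.
by rewrite probability_setC ?muS ?subee //; exact: closed_borel.
Qed.

(** If [O] were null, its complement would be a closed set of full measure, hence would contain the
    support and with it [x]. *)
Lemma support_nbhs (mu : probability (borel X) R) (S O : set X) (x : X) :
  is_support mu S -> S x -> open O -> O x -> (0 < mu O)%E.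
Proof.
move=> [cS muS Smin] Sx oO Ox; rewrite lt0e measure_ge0 andbT; apply/eqP => O0.
have : S `<=` ~` O; last by move=> /(_ _ Sx).
apply: Smin; first exact: open_closedC.
by rewrite probability_setC ?O0 ?sube0 //; exact: sub_sigma_algebra.
Qed.

End borel_theory.

(** * Weighted averages *)

Section averages.
Context {R : realType} {d : measure_display} {T : measurableType d}.
Context {mu : probability T R}.
Implicit Types (f a b g : T -> R[i]) (r : T -> R).

(** The difference [r2 - r1] agrees almost everywhere with its absolute value, whose integral is
    nonnegative. *)
Lemma ae_le_Rintegral (r1 r2 : T -> R) : mu.-integrable setT (EFin \o r1) ->
  mu.-integrable setT (EFin \o r2) -> {ae mu, forall x, r1 x <= r2 x} ->
  \int[mu]_x r1 x <= \int[mu]_x r2 x.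
Proof.
move=> i1 i2 r12; rewrite -subr_ge0 -RintegralB //.
have m1 : measurable_fun setT r1 by apply/measurable_EFinP/(measurable_int mu).
have m2 : measurable_fun setT r2 by apply/measurable_EFinP/(measurable_int mu).
have m21 : measurable_fun setT (fun x => r2 x - r1 x) by exact: measurable_funB.
rewrite [leRHS](_ : _ = \int[mu]_x `|r2 x - r1 x|); first exact: Rintegral_ge0.
congr fine; apply: ae_eq_integral => //.
- exact/measurable_EFinP.
- by apply/measurable_EFinP; exact: measurableT_comp.
- by apply: filterS r12 => x h _; rewrite ger0_norm // subr_ge0.
Qed.

Lemma cintegralR r : cintegral mu (fun x => (r x)%:C%C) = (\int[mu]_x r x)%:C%C.
Proof.
apply/eqP; rewrite eq_complex /= eqxx /=; apply/eqP.
by rewrite Rintegral_cst // mul0r.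
Qed.

(** The factor 2 comes from estimating the real and the imaginary part separately; it is absorbed in
    the choice of constants in [wratio_concentration]. *)
Lemma rnorm_cintegral_le g r (B : R) : cmeasurable g ->
  (forall x, rnorm (g x) <= B) -> mu.-integrable setT (EFin \o r) ->
  {ae mu, forall x, rnorm (g x) <= r x} ->
  rnorm (cintegral mu g) <= 2 * \int[mu]_x r x.
Proof.
move=> [m1 m2] gB ir gr.
have part (p : T -> R) : measurable_fun setT p -> (forall x, `|p x| <= rnorm (g x)) ->
    `|\int[mu]_x p x| <= \int[mu]_x r x.
  move=> mp pg; have ip : mu.-integrable setT (EFin \o p).
    by apply: (bounded_integrable mp) => x; exact: le_trans (gB x).
  apply: le_trans (le_normr_Rintegral _ _) _ => //.
  apply: ae_le_Rintegral => //; first exact: integrable_norm.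
  by apply: filterS gr => x; exact: le_trans.
apply: le_trans (rnorm_le _) _; rewrite mulr_natl mulr2n /=.
by apply: lerD; apply: part => // x; [exact: Re_le_rnorm|exact: Im_le_rnorm].
Qed.

Definition wavg (m : nat) f a : R[i] := cintegral mu (fun y => a y ^+ m * f y).

(** Its value is 0 where the denominator vanishes; the estimates below assume a positive lower bound
    on the modulus of the denominator. *)
Definition wratio (m : nat) f a : R[i] := wavg m f a / wavg m (fun=> 1) a.

Lemma wavg_lower m r (B c : R) : measurable_fun setT r ->
  (forall x, 0 <= r x <= B) -> 0 < c -> {ae mu, forall x, c <= r x} ->
  wavg m (fun=> 1) (fun x => (r x)%:C%C) = (\int[mu]_x (r x ^+ m))%:C%C /\
  c ^+ m <= \int[mu]_x (r x ^+ m).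
Proof.
move=> mr rB c0 cr.
have irm : mu.-integrable setT (EFin \o (fun x => r x ^+ m)).
  apply: (@bounded_integrable _ _ _ _ _ (B ^+ m)); first exact: measurable_funX.
  move=> x; have /andP[r0 rB'] := rB x; rewrite normrX ger0_norm // lerXn2r //.
  by rewrite nnegrE (le_trans r0).
split.
  by rewrite -cintegralR; congr cintegral; apply/funext => x; rewrite mulr1 -rmorphXn.
have -> : c ^+ m = \int[mu]_x (c ^+ m).
  rewrite Rintegral_cst // [X in _ * X](_ : _ = 1) ?mulr1 //.
  exact: (congr1 fine (probability_setT mu)).
apply: ae_le_Rintegral => //.
  apply: (@bounded_integrable _ _ _ _ _ `|c ^+ m|) => //; exact: measurable_cst.
by apply: filterS cr => x cx; rewrite lerXn2r // nnegrE ?ltW // (lt_le_trans c0).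
Qed.

Context {H : L2space mu}.

(** Induction on [m], splitting the difference of powers as
    [x * (x ^+ m - y ^+ m) + (x - y) * y ^+ m]. *)
Lemma pow_lipschitz (B : R) m : 0 <= B -> exists2 K : R, 0 <= K &
  forall x y : R[i], rnorm x <= B -> rnorm y <= B ->
    rnorm (x ^+ m - y ^+ m) <= K * rnorm (x - y).
Proof.
move=> B0; elim: m => [|m [K K0 IH]].
  by exists 0 => // x y _ _; rewrite subrr rnorm0 mul0r.
exists (B * K + B ^+ m); first by rewrite addr_ge0 ?mulr_ge0 ?exprn_ge0.
move=> x y xB yB.
rewrite (_ : _ - _ = x * (x ^+ m - y ^+ m) + (x - y) * y ^+ m); last first.
  by rewrite !exprS; ring.
apply: le_trans (rnormD _ _) _; rewrite !rnormM mulrDl rnormX -mulrA.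
apply: lerD; first by apply: ler_pM; rewrite ?rnorm_ge0 ?IH.
by rewrite mulrC ler_wpM2r ?rnorm_ge0 // lerXn2r ?nnegrE ?rnorm_ge0.
Qed.

Lemma wavg_square_integrable m f a (B Bf : R) : cmeasurable f -> cmeasurable a ->
  (forall x, rnorm (f x) <= Bf) -> (forall x, rnorm (a x) <= B) ->
  square_integrable mu (fun y => a y ^+ m * f y).
Proof.
move=> mf ma fB aB; apply: (@bounded_square_integrable _ _ _ _ _ (B ^+ m * Bf)).
  by apply: cmeasurableM => //; exact: cmeasurableX.
move=> x; rewrite rnormM rnormX ler_pM ?exprn_ge0 ?rnorm_ge0 //.
by rewrite lerXn2r // nnegrE ?rnorm_ge0 // (le_trans _ (aB x)) ?rnorm_ge0.
Qed.

(** Cauchy-Schwarz against the constant 1, a unit vector of [H]; for a constant majorant this avoids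
    the factor 2. *)
Lemma rnorm_cintegral_cst g (B : R) : 0 <= B -> square_integrable mu g ->
  {ae mu, forall x, rnorm (g x) <= B} -> rnorm (cintegral mu g) <= B.
Proof.
move=> B0 sg gB; rewrite (cintegral_dot (H := H)) //.
apply: le_trans (rnorm_hdot _ _) _; rewrite (rnorm_cls_cst (ler01 : 0 <= 1 :> R)) mul1r.
exact: rnorm_cls_le_cst.
Qed.

Lemma wavg_bound m f a (B Bf : R) : cmeasurable f -> cmeasurable a ->
  (forall x, rnorm (f x) <= Bf) -> (forall x, rnorm (a x) <= B) ->
  0 <= Bf -> 0 <= B -> rnorm (wavg m f a) <= B ^+ m * Bf.
Proof.
move=> mf ma fB aB Bf0 B0; apply: rnorm_cintegral_cst.
- by rewrite mulr_ge0 ?exprn_ge0.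
- exact: wavg_square_integrable fB aB.
- apply: aeW => x; rewrite rnormM rnormX ler_pM ?exprn_ge0 ?rnorm_ge0 //.
  by rewrite lerXn2r // nnegrE rnorm_ge0.
Qed.

(** The constant is chosen before the functions and depends only on [m] and their bounds. It can
    therefore serve all points [x] and all parameters of the weights at once. *)
Lemma wavg_lipschitz m (B Bf : R) : 0 <= B -> 0 <= Bf -> exists2 K : R, 0 <= K &
  forall f a b e, cmeasurable f -> cmeasurable a -> cmeasurable b ->
    (forall x, rnorm (f x) <= Bf) -> (forall x, rnorm (a x) <= B) ->
    (forall x, rnorm (b x) <= B) -> 0 <= e ->
    {ae mu, forall x, rnorm (a x - b x) <= e} ->
    rnorm (wavg m f a - wavg m f b) <= K * e.
Proof.
move=> B0 Bf0; have [K K0 Klip] := pow_lipschitz m B0.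
exists (K * Bf); first by rewrite mulr_ge0.
move=> f a b e mf ma mb fB aB bB e0 ab.
have sa := wavg_square_integrable m mf ma fB aB.
have sb := wavg_square_integrable m mf mb fB bB.
have -> : wavg m f a - wavg m f b = cintegral mu (fun y => a y ^+ m * f y - b y ^+ m * f y).
  rewrite /wavg !(cintegral_dot (H := H)) //; last exact: square_integrableB.
  by rewrite -hdotBr clsB.
apply: rnorm_cintegral_cst; [by rewrite !mulr_ge0|exact: square_integrableB|].
apply: filterS ab => x abx; rewrite -mulrBl rnormM mulrAC ler_pM ?rnorm_ge0 //.
by apply: le_trans (Klip _ _ _ _) _ => //; rewrite ler_wpM2l.
Qed.

Lemma wratio_lipschitz m (B Bf c : R) : 0 <= B -> 0 <= Bf -> 0 < c ->
  exists2 K : R, 0 <= K &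
  forall f a b e, cmeasurable f -> cmeasurable a -> cmeasurable b ->
    (forall x, rnorm (f x) <= Bf) -> (forall x, rnorm (a x) <= B) ->
    (forall x, rnorm (b x) <= B) -> 0 <= e ->
    {ae mu, forall x, rnorm (a x - b x) <= e} ->
    c <= rnorm (wavg m (fun=> 1) a) -> c <= rnorm (wavg m (fun=> 1) b) ->
    rnorm (wratio m f a - wratio m f b) <= K * e.
Proof.
move=> B0 Bf0 c0.
have [K1 K10 lip1] := wavg_lipschitz m B0 Bf0.
have [K2 K20 lip2] := wavg_lipschitz m B0 (ler01 : 0 <= 1 :> R).
(* The first summand bounds the change of the numerator over [D]; the second bounds
   [N' * (D - D') / (D * D')], with [B ^+ m * Bf] a bound for [N']. *)
exists (K1 / c + B ^+ m * Bf * K2 / c ^+ 2).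
  apply: addr_ge0; first exact: divr_ge0 K10 (ltW c0).
  by apply: divr_ge0; rewrite ?sqr_ge0 // !mulr_ge0 ?exprn_ge0.
move=> f a b e mf ma mb fB aB bB e0 ab ca cb.
have m1 : cmeasurable (fun _ : T => (1 : R[i])) by exact: cmeasurable_cst.
have b1 (x : T) : rnorm (1 : R[i]) <= 1 by rewrite rnorm1.
have h1 := lip1 _ _ _ _ mf ma mb fB aB bB e0 ab.
have h2 := lip2 _ _ _ _ m1 ma mb b1 aB bB e0 ab.
have h3 := wavg_bound m mf mb fB bB Bf0 B0.
have a0 : wavg m (fun=> 1) a != 0 by exact: rnorm_neq0 c0 ca.
have b0 : wavg m (fun=> 1) b != 0 by exact: rnorm_neq0 c0 cb.
rewrite /wratio; move: h1 h2 h3 ca cb a0 b0.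
move: (wavg m f a) (wavg m f b) (wavg m (fun=> 1) a) (wavg m (fun=> 1) b) => N N' D D' h1 h2 h3 ca cb a0 b0.
have -> : N / D - N' / D' = (N - N') / D - N' * (D - D') / (D * D').
  by field; rewrite a0 b0.
apply: le_trans (rnormD _ _) _; rewrite rnormN [leRHS]mulrDl.
have iD : rnorm D^-1 <= c^-1 by rewrite rnormV lef_pV2 // posrE (lt_le_trans c0).
have iD' : rnorm D'^-1 <= c^-1 by rewrite rnormV lef_pV2 // posrE (lt_le_trans c0).
apply: lerD.
  by rewrite rnormM mulrAC ler_pM ?rnorm_ge0.
rewrite invfM !rnormM expr2 invfM.
rewrite (_ : _ * e = (B ^+ m * Bf) * (K2 * e) * (c^-1 * c^-1)); last by ring.
have r0 (z : R[i]) := rnorm_ge0 z.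
by apply: ler_pM; rewrite ?mulr_ge0 //; apply: ler_pM.
Qed.

End averages.

Arguments wavg {R d T} mu m f a.
Arguments wratio {R d T} mu m f a.

(** * Contractivity of the inclusions of the kernel spaces *)

Section rkhs_theory.
Context {R : realType} {X : ptopologicalType} {k : X -> X -> R} {Hk : rkhs k}.
Hypothesis k_bounded : bounded_kernel k.
Hypothesis k_continuous : continuous_kernel k.

Lemma hdot_section x y :
  hdot (rk_section Hk x) (rk_section Hk y) = (k y x)%:C%C.
Proof. by rewrite -rk_reproducing rk_sectionE. Qed.

Lemma rnorm_section_sqr x : rnorm (rk_section Hk x) ^+ 2 = k x x.
Proof. by apply: complexI; rewrite -hdot_rnorm hdot_section. Qed.

Lemma rnorm_section_le x : rnorm (rk_section Hk x) <= rk_varpi Hk.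
Proof.
have [B kB] := k_bounded.
apply: ub_le_sup; last by exists x.
exists (Num.sqrt B) => _ [y _ <-].
by rewrite -[leLHS]ger0_norm ?rnorm_ge0 // -sqrtr_sqr ler_wsqrtr // [leLHS]rnorm_section_sqr.
Qed.

Lemma varpi_gt0 x : 0 < k x x -> 0 < rk_varpi Hk.
Proof.
move=> kx; apply: lt_le_trans (rnorm_section_le x).
by rewrite lt_neqAle rnorm_ge0 andbT eq_sym -sqrf_eq0 rnorm_section_sqr gt_eqF.
Qed.

(** By the reproducing property the squared distance of two sections is [k x x + k y y - 2 * k y x],
    which tends to 0 as [y] tends to [x]. *)
Lemma section_continuous : continuous (rk_section Hk : X -> Hk).
Proof.
move=> x; apply/cvg_rnormP => e e0.
have kxx : (fun y => k x x + k y y - 2 * k y x) y @[y --> x] --> (0 : R).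
  rewrite [X in _ --> X](_ : 0 = k x x + k x x - 2 * k x x); last by ring.
  have c1 : {for x, continuous ((fun p : X * X => k p.1 p.2) \o (fun y => (y, y)))}.
    by apply: continuous_comp; [apply: cvg_pair; exact: cvg_id|exact: k_continuous].
  have c2 : {for x, continuous ((fun p : X * X => k p.1 p.2) \o (fun y => (y, x)))}.
    apply: continuous_comp; last exact: k_continuous.
    by apply: cvg_pair; [exact: cvg_id|exact: cvg_cst].
  by apply: cvgB; [apply: cvgD => //; exact: cvg_cst|apply: cvgMr].
have /cvgrPdist_lt/(_ _ (exprn_gt0 2 e0)) := kxx.
apply: filterS => y; rewrite sub0r normrN.
have -> : k x x + k y y - 2 * k y x = rnorm (rk_section Hk x - rk_section Hk y) ^+ 2.
  by rewrite rnorm_sqrB !rnorm_section_sqr hdot_section.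
by rewrite ger0_norm ?sqr_ge0 // ltr_pXn2r ?nnegrE ?rnorm_ge0 // ltW.
Qed.

Lemma rk_eval_continuous (h : Hk) : continuous (rk_eval Hk h).
Proof.
move=> x; rewrite (_ : rk_eval Hk h = (fun y => hdot (rk_section Hk y) h)); last first.
  by apply/funext => y; rewrite rk_reproducing.
by apply: continuous_comp; [exact: section_continuous|exact: hdot_continuousl].
Qed.

Lemma rk_eval_le (h : Hk) x : rnorm (rk_eval Hk h x) <= rk_varpi Hk * rnorm h.
Proof.
rewrite rk_reproducing; apply: le_trans (rnorm_hdot _ _) _.
by rewrite ler_wpM2r ?rnorm_ge0 // rnorm_section_le.
Qed.

Lemma rk_evalB (g h : Hk) x : rk_eval Hk (g - h) x = rk_eval Hk g x - rk_eval Hk h x.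
Proof. by rewrite -scaleN1r addrC rk_linear mulN1r addrC. Qed.

Context {mu : probability (borel X) R} {H : L2space mu}.

(** This gives [rk_class] its meaning, since [cls] is specified on square-integrable functions
    only. *)
Lemma rk_eval_square_integrable (h : Hk) : square_integrable mu (rk_eval Hk h).
Proof.
apply: (@bounded_square_integrable _ _ (borel X) mu _ (rk_varpi Hk * rnorm h)).
  exact/continuous_cmeasurable/rk_eval_continuous.
exact: rk_eval_le.
Qed.

Lemma rk_classB (g h : Hk) : rk_class H (g - h) = rk_class H g - rk_class H h.
Proof.
rewrite /rk_class clsB; [|exact: rk_eval_square_integrable..].
by congr cls; apply/funext => x; rewrite rk_evalB.
Qed.

(** A crude bound whose constant depends on the kernel; it is the a priori bound from which
    [rk_class_contraction] obtains the constant 1. *)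
Lemma rnorm_rk_class_le (h : Hk) : rnorm (rk_class H h) <= rk_varpi Hk * rnorm h.
Proof.
apply: rnorm_cls_le_cst; first exact: rk_eval_square_integrable.
  by rewrite mulr_ge0 ?rnorm_ge0 // (le_trans _ (rnorm_section_le point)) ?rnorm_ge0.
by apply: aeW => x; exact: rk_eval_le.
Qed.

End rkhs_theory.

Section contraction.
Context {R : realType} {X : ptopologicalType}.
Context {mu : probability (borel X) R} {H : L2space mu}.
Context {k : R -> X -> X -> R} {Hk : forall tau, rkhs (k tau)}.
Context {K : forall tau, H -> Hk tau}.
Hypothesis k_bounded : forall tau, 0 < tau -> bounded_kernel (k tau).
Hypothesis k_continuous : forall tau, 0 < tau -> continuous_kernel (k tau).
Hypothesis K_adjoint : forall tau, 0 < tau ->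
  is_adjoint (K tau) (@rk_class _ _ _ H _ (Hk tau)).
Hypothesis K3 : forall tau tau' (f : H), 0 <= tau -> 0 <= tau' ->
  Gop K tau (Gop K tau' f) = Gop K (tau + tau') f.
Hypothesis Hk_nested : forall tau sigma (h : Hk sigma), 0 < tau -> tau <= sigma ->
  exists2 g : Hk tau, rk_eval (Hk tau) g = rk_eval (Hk sigma) h & hnorm g <= hnorm h.

Lemma GopE tau (u : H) : 0 < tau -> Gop K tau u = rk_class H (K tau u).
Proof. by move=> t0; rewrite /Gop gt_eqF. Qed.

Lemma hdot_Gop tau (u v : H) : 0 < tau ->
  hdot u (Gop K tau v) = hdot (K tau u) (K tau v).
Proof. by move=> t0; rewrite GopE // K_adjoint. Qed.

(** For [tau >= s] the space [Hk tau] embeds contractively in [Hk s], so its inclusion into [H] has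
    norm at most [rk_varpi (Hk s)]. Its adjoint [K tau] obeys the same bound, and [Gop] is the
    product of the two. Uniformity over all large [tau] is what the doubling argument for the
    contraction needs. *)
Lemma rnorm_Gop_bound s : 0 < s -> exists2 B : R, 0 <= B &
  forall tau (u : H), s <= tau -> rnorm (Gop K tau u) <= B * rnorm u.
Proof.
move=> s0; pose c := rk_varpi (Hk s); exists (c ^+ 2); first exact: sqr_ge0.
have c0 : 0 <= c.
  exact: le_trans (rnorm_ge0 _) (rnorm_section_le (Hk := Hk s) (k_bounded s0) point).
move=> tau u st; have t0 : 0 < tau by exact: lt_le_trans st.
have cls_le (h : Hk tau) : rnorm (rk_class H h) <= c * rnorm h.
  have [g gh gle] := Hk_nested h s0 st.
  rewrite /rk_class -gh; apply: le_trans (rnorm_rk_class_le _ _ g) _.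
  - exact: k_bounded.
  - exact: k_continuous.
  - exact: ler_wpM2l gle.
have Ku : rnorm (K tau u) <= c * rnorm u.
  have [->|Ku0] := eqVneq (rnorm (K tau u)) 0; first by rewrite mulr_ge0 ?rnorm_ge0.
  have Kpos : 0 < rnorm (K tau u) by rewrite lt_neqAle eq_sym Ku0 rnorm_ge0.
  rewrite -(ler_pM2r Kpos) -expr2.
  have -> : rnorm (K tau u) ^+ 2 = rnorm (hdot u (Gop K tau u)).
    by rewrite hdot_Gop // hdot_rnorm rnormR ger0_norm ?sqr_ge0.
  apply: le_trans (rnorm_hdot _ _) _; rewrite GopE // mulrAC mulrC.
  by rewrite ler_wpM2r ?rnorm_ge0.
rewrite GopE //; apply: le_trans (cls_le _) _.
by rewrite expr2 -mulrA ler_wpM2l.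
Qed.

(* Self-adjointness gives [|G_s u|^2 <= |u| |G_(2s) u|]; iterating, a ratio
   [|G_s u| / |u| > 1] would make [|G_(2^n s) u|] unbounded. *)
Lemma Gop_contraction tau (u : H) : 0 < tau -> rnorm (Gop K tau u) <= rnorm u.
Proof.
move=> t0; rewrite leNgt; apply/negP => lt_u.
have u0 : 0 < rnorm u.
  rewrite lt_neqAle rnorm_ge0 andbT eq_sym; apply/eqP => u0.
  have [B _ /(_ tau u (lexx _))] := rnorm_Gop_bound t0.
  by rewrite u0 mulr0 leNgt -u0 lt_u.
have dbl s : 0 < s -> rnorm (Gop K s u) ^+ 2 <= rnorm u * rnorm (Gop K (s + s) u).
  move=> s0; rewrite -K3 ?(ltW s0) //; set v := Gop K s u.
  apply: le_trans (rnorm_hdot _ _).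
  rewrite hdot_Gop // (hdotC (K s u)) -hdot_Gop // rnormJ -/v.
  by rewrite hdot_rnorm rnormR ger0_norm ?sqr_ge0.
pose r := rnorm (Gop K tau u) / rnorm u.
have r1 : 1 < r by rewrite ltr_pdivlMr ?mul1r.
pose a n := rnorm (Gop K (tau * 2 ^+ n) u) / rnorm u.
(* Squaring at each step would even give the exponent [2 ^ n]; the exponent [n.+1] is enough for
   unboundedness. *)
have ar n : r ^+ n.+1 <= a n.
  elim: n => [|n IH]; first by rewrite expr1 /a expr0 mulr1.
  have an1 : a n ^+ 2 <= a n.+1.
    have tn : 0 < tau * 2 ^+ n by rewrite mulr_gt0 ?exprn_gt0.
    rewrite /a expr_div_n ler_pdivrMr ?exprn_gt0 //.
    rewrite (_ : tau * 2 ^+ n.+1 = tau * 2 ^+ n + tau * 2 ^+ n); last first.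
      by rewrite exprS; ring.
    apply: le_trans (dbl _ tn) _; rewrite le_eqVlt; apply/orP; left; apply/eqP.
    by field; rewrite gt_eqF.
  apply: le_trans an1; apply: (@le_trans _ _ ((r ^+ n.+1) ^+ 2)).
    rewrite -exprM; apply: ler_weXn2l; first exact: ltW.
    by rewrite muln2 -addnn addnS addSn !ltnS leq_addr.
  by rewrite lerXn2r // nnegrE ?exprn_ge0 ?divr_ge0 ?rnorm_ge0 // ltW // (lt_trans ltr01).
have [B B0 aB] := rnorm_Gop_bound t0.
have rB n : r ^+ n.+1 <= B.
  apply: le_trans (ar n) _; rewrite ler_pdivrMr //; apply: aB.
  apply: ler_peMr; first exact: ltW.
  by apply: exprn_ege1; rewrite ler1n.
have bern n : 1 + (r - 1) * n%:R <= r ^+ n.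
  elim: n => [|n IH]; first by rewrite mulr0 addr0 expr0.
  rewrite exprS; apply: (@le_trans _ _ (r * (1 + (r - 1) * n%:R))); last first.
    by rewrite ler_pM2l // (lt_trans ltr01).
  by have := mulr_ge0 (sqr_ge0 (r - 1)) (ler0n R n); rewrite -natr1; lra.
have [n Bn] : exists n : nat, B < (r - 1) * n%:R.
  exists (Num.bound (B / (r - 1))).
  rewrite mulrC -ltr_pdivrMr ?subr_gt0 //; apply: archi_boundP.
  by rewrite divr_ge0 // subr_ge0 ltW.
have := rB n; have := bern n.+1; rewrite -natr1 => h1 h2.
by move: r1 Bn; nra.
Qed.

(** With [u] the class of [h], the squared norm of [K tau u] is the inner product of [u] with
    [Gop K tau u], so [K tau] does not increase the norm of [u]. The squared norm of [u] equals the
    inner product of [K tau u] with [h], and dividing by the norm of [u] finishes the estimate. *)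
Lemma rk_class_contraction tau (h : Hk tau) : 0 < tau ->
  rnorm (rk_class H h) <= rnorm h.
Proof.
move=> t0; set u := rk_class H h.
have [->|u0'] := eqVneq (rnorm u) 0; first exact: rnorm_ge0.
have u0 : 0 < rnorm u by rewrite lt_neqAle eq_sym u0' rnorm_ge0.
have Ku : rnorm (K tau u) <= rnorm u.
  rewrite -(@ler_pXn2r _ 2) ?nnegrE ?rnorm_ge0 //.
  have -> : rnorm (K tau u) ^+ 2 = rnorm (hdot u (Gop K tau u)).
    by rewrite hdot_Gop // hdot_rnorm rnormR ger0_norm ?sqr_ge0.
  apply: le_trans (rnorm_hdot _ _) _.
  by rewrite expr2 ler_wpM2l ?rnorm_ge0 // Gop_contraction.
rewrite -(ler_pM2l u0) -expr2.
have -> : rnorm u ^+ 2 = rnorm (hdot (K tau u) h).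
  by rewrite K_adjoint // hdot_rnorm rnormR ger0_norm ?sqr_ge0.
by apply: le_trans (rnorm_hdot _ _) _; rewrite ler_wpM2r ?rnorm_ge0.
Qed.

End contraction.

(** * Classes of [kappa] in L^2 and continuity of weighted quotients on [M] *)

Section kernel_average.
Context {R : realType} {X : ptopologicalType} {mu : probability (borel X) R}.
Context {H : L2space mu} {Xmu M : set X}.
Hypothesis Xmu_support : is_support mu Xmu.
Hypothesis Xmu_M : Xmu `<=` M.
Hypothesis M_compact : compact M.
Hypothesis X_hausdorff : hausdorff_space X.
Context {kappa : X -> X -> R}.
Hypothesis kappa_gt0 : forall x y, 0 < kappa x y.
Hypothesis kappa_bounded : bounded_kernel kappa.
Hypothesis kappa_continuous : continuous_kernel kappa.

Lemma M_closed : closed M.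
Proof. exact: compact_closed. Qed.

Lemma ae_M : {ae mu, forall x : borel X, M x}.
Proof. exact: (@ae_sub R _ (borel X) mu Xmu M Xmu_M (support_ae Xmu_support)). Qed.

Lemma M_nonempty : M !=set0.
Proof.
apply/set0P/eqP => M0; have [_ muX _] := Xmu_support.
have Xmu0 : Xmu = set0 by apply/seteqP; split => // x /Xmu_M; rewrite M0.
by move: muX; rewrite Xmu0 measure0 => /esym/eqP; rewrite onee_eq0.
Qed.

Lemma kappa_continuousl x : continuous (kappa x).
Proof. exact: (continuous_partiall kappa_continuous). Qed.

Lemma kappa_continuousr y : continuous (kappa^~ y).
Proof. exact: (continuous_partialr kappa_continuous). Qed.

Lemma realC_continuous : continuous (fun r : R => r%:C%C : R[i]).
Proof.
move=> r; apply/cvg_rnormP => e e0; apply/nbhs_ballP; exists e => // s rs.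
by rewrite -rmorphB rnormR.
Qed.

Lemma continuousC (g : X -> R) : continuous g -> continuous (fun x => (g x)%:C%C : R[i]).
Proof.
by move=> cg x; apply: continuous_comp; [exact: cg|exact: realC_continuous].
Qed.

Lemma continuousC_within (g : X -> R) :
  continuous g -> {within M, continuous (fun x => (g x)%:C%C : R[i])}.
Proof.
by move=> /continuousC; exact: continuous_subspaceT.
Qed.

Lemma patch_square_integrable (f : X -> R[i]) (B : R) :
  {within M, continuous f} -> (forall x, M x -> rnorm (f x) <= B) ->
  square_integrable mu (patch (fun=> 0) M f).
Proof.
move=> cf fB; apply: (@bounded_square_integrable _ _ (borel X) mu _ B).
  exact: patch_cmeasurable M_closed cf.
have [x0 Mx0] := M_nonempty.
move=> x; rewrite patchE; case: ifPn => [|_]; first by rewrite inE; exact: fB.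
by rewrite rnorm0 (le_trans (rnorm_ge0 _) (fB _ Mx0)).
Qed.

Lemma patch_continuous_square_integrable (f : X -> R[i]) :
  {within M, continuous f} -> square_integrable mu (patch (fun=> 0) M f).
Proof.
move=> cf; have [B _ fB] := compact_rnorm_bounded M_compact cf.
exact: patch_square_integrable fB.
Qed.

Lemma patch_bounded (f : X -> R[i]) : {within M, continuous f} ->
  exists2 B : R, 0 <= B & forall x, rnorm (patch (fun=> 0) M f x) <= B.
Proof.
move=> cf; have [B B0 fB] := compact_rnorm_bounded M_compact cf; exists B => // x.
by rewrite patchE; case: ifPn => [|_]; [rewrite inE; exact: fB|rewrite rnorm0].
Qed.

Lemma rnorm_iotaM_dist (u v : X -> R[i]) (e : R) :
  square_integrable mu (patch (fun=> 0) M u) ->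
  square_integrable mu (patch (fun=> 0) M v) -> 0 <= e ->
  (forall x, Xmu x -> rnorm (u x - v x) <= e) ->
  rnorm (iotaM H M u - iotaM H M v) <= e.
Proof.
move=> su sv e0 uv; rewrite /iotaM clsB //.
apply: rnorm_cls_le_cst; [exact: square_integrableB|exact: e0|].
apply: ae_sub (support_ae Xmu_support) => x Xx; have Mx := Xmu_M Xx.
by rewrite !patchE (mem_set Mx) uv.
Qed.

Definition kappa_class (y : X) : H := iotaM H M (fun x => (kappa x y)%:C%C).

(** Nearby [y] give functions uniformly close on [M]. This makes every weight of the form
    [hdot q (kappa_class y)] continuous in [y], hence Borel. *)
Lemma kappa_class_continuous : continuous kappa_class.
Proof.
move=> y; apply/cvg_rnormP => e e0.
have e2 : 0 < e / 2 by rewrite divr_gt0.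
have csw : continuous (fun p : X * X => kappa p.2 p.1).
  exact: (continuous_swap kappa_continuous).
have := compact_unif_near (g := fun y z => kappa z y) y M_compact csw e2.
apply: filterS => y' yy'; apply: (@le_lt_trans _ _ (e / 2)); last by rewrite ltr_pdivrMr //; lra.
have s z : square_integrable mu (patch (fun=> 0) M (fun x => (kappa x z)%:C%C : R[i])).
  exact/patch_continuous_square_integrable/continuousC_within/kappa_continuousr.
rewrite /kappa_class /iotaM clsB //; apply: rnorm_cls_le_cst; [exact: square_integrableB|exact: ltW|].
apply: ae_all => x; rewrite !patchE; case: ifPn => [|_]; last by rewrite subrr rnorm0 ltW.
by rewrite inE -rmorphB rnormR => Mx; exact/ltW/yy'.
Qed.

Lemma rnorm_kappa_class (B : R) y : (forall x y, kappa x y <= B) ->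
  rnorm (kappa_class y) <= B.
Proof.
move=> kB; have B0 : 0 <= B by exact: le_trans (ltW (kappa_gt0 y y)) (kB _ _).
apply: rnorm_cls_le_cst => //.
  exact/patch_continuous_square_integrable/continuousC_within/kappa_continuousr.
apply: ae_all => x; rewrite patchE; case: ifPn => _; last by rewrite rnorm0.
by rewrite rnormR ger0_norm // ltW.
Qed.

Lemma hdot_kappa_class_cmeasurable (q : H) :
  cmeasurable ((fun y => hdot q (kappa_class y)) : borel X -> R[i]).
Proof.
apply: continuous_cmeasurable => y.
by apply: continuous_comp; [exact: kappa_class_continuous|exact: hdot_continuousr].
Qed.

(** Stated for an arbitrary family of weights, because it is applied to [kappa] itself, to its
    averages along the flow and to the regularized weights. *)
Lemma wratio_within_continuous (a : X -> X -> R[i]) m (f : X -> R[i]) (B Bf c : R) :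
  cmeasurable (f : borel X -> R[i]) -> (forall x, rnorm (f x) <= Bf) ->
  (forall x, cmeasurable (a x : borel X -> R[i])) ->
  (forall x y, M x -> rnorm (a x y) <= B) -> 0 < c ->
  (forall x, M x -> c <= rnorm (wavg mu m (fun=> 1) (a x))) ->
  (forall x e, M x -> 0 < e ->
    \forall x' \near x, M x' -> {ae mu, forall y, rnorm (a x y - a x' y) <= e}) ->
  {within M, continuous (fun x => wratio mu m f (a x))} /\
  forall x, M x -> rnorm (wratio mu m f (a x)) <= B ^+ m * Bf / c.
Proof.
move=> mf fB ma aB c0 ac a_cont.
have Bf0 : 0 <= Bf by exact: le_trans (rnorm_ge0 _) (fB point).
have [x0 Mx0] := M_nonempty.
have B0 : 0 <= B by exact: le_trans (rnorm_ge0 _) (aB x0 point Mx0).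
have [L L0 lip] := wratio_lipschitz (mu := mu) (H := H) m B0 Bf0 c0.
split.
  apply/subspace_continuousP => x Mx; apply/cvg_rnormP => e e0.
  (* [L] may be 0, hence [L + 1]; halving makes the final inequality strict. *)
  have e1 : 0 < e / (L + 1) / 2 by rewrite !divr_gt0 // ltr_wpDl.
  have := a_cont x _ Mx e1; apply: filterS => x' ae_x' Mx'.
  have := lip f (a x) (a x') _ mf (ma x) (ma x') fB (aB x ^~ Mx) (aB x' ^~ Mx')
    (ltW e1) (ae_x' Mx') (ac _ Mx) (ac _ Mx').
  move=> le; apply: le_lt_trans le _.
  rewrite !mulrA ltr_pdivrMr // ltr_pdivrMr ?ltr_wpDl //.
  nra.
move=> x Mx; rewrite rnormM rnormV ler_pM ?rnorm_ge0 ?invr_ge0 ?rnorm_ge0 //.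
  exact: (wavg_bound (H := H) m mf (ma x) fB (aB x ^~ Mx) Bf0 B0).
by rewrite lef_pV2 ?posrE ?(lt_le_trans c0) // ac.
Qed.

Lemma wavg_kappa_lower m : exists2 c : R, 0 < c & forall z, M z ->
  c <= rnorm (wavg mu m (fun=> 1) (fun y => (kappa z y)%:C%C)).
Proof.
have [c c0 cM] := compact_pos_lower M_compact kappa_continuous (fun p => kappa_gt0 p.1 p.2).
have [Bk kB] := kappa_bounded.
exists (c ^+ m); first exact: exprn_gt0.
move=> z Mz; have mk : measurable_fun setT (kappa z : borel X -> R).
  by have [] := continuous_cmeasurable (continuousC (kappa_continuousl (x := z))).
have k0B y : 0 <= kappa z y <= Bk by rewrite kB ltW.
have cae : {ae mu, forall y, c <= kappa z y}.
  by apply: ae_sub ae_M => y; exact: cM.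
have [-> h] := wavg_lower m mk k0B c0 cae.
by rewrite rnormR (le_trans h) // ler_norm.
Qed.

Lemma wratio_kappa_continuous m (f : X -> R[i]) (Bf : R) :
  cmeasurable (f : borel X -> R[i]) -> (forall x, rnorm (f x) <= Bf) ->
  {within M, continuous (fun z => wratio mu m f (fun y => (kappa z y)%:C%C))}.
Proof.
move=> mf fB; have [c c0 clow] := wavg_kappa_lower m; have [Bk kB] := kappa_bounded.
apply: (wratio_within_continuous (B := Bk) mf fB _ _ c0 clow _).1.
- by move=> x; exact/continuous_cmeasurable/continuousC/kappa_continuousl.
- by move=> x y _; rewrite rnormR ger0_norm // ltW.
- move=> x e Mx e0; have := compact_unif_near x M_compact kappa_continuous e0.
  apply: filterS => x' xx' _; apply: ae_sub ae_M => y My.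
  by rewrite -rmorphB rnormR; exact/ltW/xx'.
Qed.

End kernel_average.

Arguments kappa_class {R X mu} H M kappa y.

(** * The limit of large exponent *)

Lemma expr_le (R : realType) n (x y : R) : 0 <= x -> x <= y -> x ^+ n <= y ^+ n.
Proof. by move=> x0 xy; rewrite lerXn2r // nnegrE (le_trans x0). Qed.

Section concentration.
Context {R : realType} {X : ptopologicalType} {mu : probability (borel X) R}.
Context {H : L2space mu} {Xmu M : set X}.
Hypothesis Xmu_support : is_support mu Xmu.
Hypothesis Xmu_compact : compact Xmu.
Hypothesis Xmu_M : Xmu `<=` M.
Hypothesis M_compact : compact M.
Hypothesis X_hausdorff : hausdorff_space X.
Context {kappa : X -> X -> R}.
Hypothesis kappa_gt0 : forall x y, 0 < kappa x y.
Hypothesis kappa_bounded : bounded_kernel kappa.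
Hypothesis kappa_continuous : continuous_kernel kappa.
Hypothesis kappa_peak : forall x y, x <> y -> kappa x y < kappa x x.

Lemma kappa_gap (z : X) (W : set X) : Xmu z -> open W -> W z ->
  exists a b : R, [/\ 0 < a, a < b & exists2 W2 : set X, open W2 /\ W2 z &
    \forall z' \near z, (forall y, Xmu y -> ~ W y -> kappa z' y <= a) /\
      (forall y, Xmu y -> W2 y -> b <= kappa z' y)].
Proof.
move=> Xz oO Oz; pose S := Xmu `&` ~` W.
have cS : compact S by apply: compact_closedI => //; exact: open_closedC.
have [a [a0 az aS]] : exists a, [/\ 0 < a, a < kappa z z & forall y, S y -> kappa z y <= a].
  (* If nothing of the support lies outside [W], any positive number below the peak will do; half of
     the peak is taken. *)
  have [S0|/set0P S0] := eqVneq S set0.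
    exists (kappa z z / 2); split; last by move=> y; rewrite S0.
      by rewrite divr_gt0.
    by rewrite ltr_pdivrMr // ltr_pMr // ltr1n.
  have [y Sy yB] := compact_EVT_max S0 cS
    (continuous_subspaceT (kappa_continuousl kappa_continuous (x := z))).
  exists (kappa z y); split => //; last by move=> x Sx; apply: yB; rewrite inE.
  by apply: kappa_peak => zy; case: (set_mem Sy); rewrite -zy => _; exact.
(* One [eta] is spent on moving [z] to [z'] outside [W], and two below the peak, for the drop inside
   [W2] and for moving [z]; the fourth separates the two thresholds. *)
pose eta := (kappa z z - a) / 4.
have eta0 : 0 < eta by rewrite divr_gt0 // subr_gt0.
exists (a + eta), (kappa z z - 2 * eta); split; [lra|rewrite /eta; lra|].
exists (kappa z @^-1` [set r | kappa z z - eta < r]).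
  split; last by rewrite /=; lra.
  by apply: open_comp; [move=> y _; exact: kappa_continuousl|exact: open_gt].
have := compact_unif_near z Xmu_compact kappa_continuous eta0.
apply: filterS => z' zz'; split => y Xy.
  move=> Oy; have := aS y (conj Xy Oy); have := zz' y Xy.
  by rewrite ltr_norml => /andP[? ?] ?; lra.
by rewrite /= => h; have := zz' y Xy; rewrite ltr_norml => /andP[? ?]; lra.
Qed.

(** Laplace's method. Near [z] the function [f] hardly varies; away from [z] the weights are at most
    [a ^+ m], while the denominator is at least [b ^+ m] times the mass of a neighbourhood, with
    [a < b]. All thresholds are locally constant in [z], so compactness of the support yields one
    bound on [m]. *)
Lemma wratio_concentration (f : X -> R[i]) (e : R) : {within M, continuous f} -> 0 < e ->
  \forall m \near \oo, forall z, Xmu z ->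
    rnorm (wratio mu m (patch (fun=> 0) M f) (fun y => (kappa z y)%:C%C) - f z) <= e.
Proof.
move=> cf e0; set g := patch (fun=> 0) M f.
have gE x : Xmu x -> g x = f x by move=> /Xmu_M Mx; rewrite /g patchE mem_set.
have mg : cmeasurable (g : borel X -> R[i]).
  exact: patch_cmeasurable (M_closed M_compact X_hausdorff) cf.
have [Bf Bf0 gB] := patch_bounded M_compact cf.
have [Bk kB] := kappa_bounded.
move/compact_near_coveringP/near_covering_withinP : Xmu_compact.
apply => z Xz.
(* Comparing [f y] with [f z'] through [f z] costs [e / 4], which the factor 2 of
   [rnorm_cintegral_le] turns into [e / 2]; the other half is for the tail. *)
have e8 : 0 < e / 8 by rewrite divr_gt0.
have [W [oO Oz fO]] : exists W : set X,
    [/\ open W, W z & forall y, W y -> Xmu y -> rnorm (f z - f y) < e / 8].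
  have cfz : nbhs z [set y | M y -> rnorm (f z - f y) < e / 8].
    have /subspace_continuousP/(_ z (Xmu_M Xz))/cvg_rnormP := cf.
    by move=> /(_ _ e8).
  move: cfz; rewrite nbhsE => -[W [oW Wz] Wsub]; exists W; split => // y Wy /Xmu_M My.
  exact: Wsub.
have [a [b [a0 ab [W2 [oO2 O2z] near_z]]]] := kappa_gap Xz oO Oz.
have b0 : 0 < b by exact: lt_trans ab.
pose p := fine (mu W2).
have mO2 : measurable (W2 : set (borel X)) by exact: sub_sigma_algebra.
have p0 : 0 < p.
  rewrite fine_gt0 // (support_nbhs Xmu_support Xz oO2 O2z) /=.
  by rewrite (le_lt_trans (probability_le1 mu mO2)) ?ltry.
(* The tail contributes [2 * (2 * Bf * a ^+ m)] to the numerator, and the denominator is at least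
   [b ^+ m * p]. *)
have ab_cvg : 4 * Bf / p * (a / b) ^+ m @[m --> \oo] --> (0 : R).
  rewrite -[X in _ --> X](mulr0 (4 * Bf / p)); apply: cvgMr; apply: cvg_expr.
  by rewrite ger0_norm ?divr_ge0 ?ltW // ltr_pdivrMr ?mul1r.
have e2 : 0 < e / 2 by rewrite divr_gt0.
have m_near : \forall m \near \oo, 4 * Bf / p * (a / b) ^+ m < e / 2.
  have /cvgrPdist_lt/(_ _ e2) := ab_cvg; apply: filterS => m.
  by rewrite sub0r normrN; apply: le_lt_trans; exact: ler_norm.
have O_near : \forall z' \near z, W z' by exact: open_nbhs_nbhs.
exists ([set z' | W z' /\ (forall y, Xmu y -> ~ W y -> kappa z' y <= a) /\
      (forall y, Xmu y -> W2 y -> b <= kappa z' y)],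
  [set m | 4 * Bf / p * (a / b) ^+ m < e / 2]).
  by split => //=; apply: filterI.
move=> [z' m] /= [[Oz' [kz1 kz2]] hm] Xz'.
pose r y := kappa z' y.
have mr : measurable_fun setT (r : borel X -> R).
  by have [] := continuous_cmeasurable (continuousC (kappa_continuousl kappa_continuous (x := z'))).
have r0 y : 0 <= r y by exact/ltW/kappa_gt0.
have rB y : r y <= Bk by exact: kB.
have irm : mu.-integrable setT (EFin \o (fun y => r y ^+ m)).
  apply: (@bounded_integrable _ _ _ _ _ (Bk ^+ m)); first exact: measurable_funX.
  by move=> y; rewrite normrX ger0_norm // expr_le.
have [c c0 cM] := compact_pos_lower M_compact kappa_continuous (fun q => kappa_gt0 q.1 q.2).
have cae : {ae mu, forall y, c <= r y}.
  by apply: ae_sub (ae_M Xmu_support Xmu_M) => y My; apply: cM => //; exact: Xmu_M.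
have k0B y : 0 <= r y <= Bk by rewrite rB r0.
have [DE Dc] := wavg_lower m mr k0B c0 cae.
pose D := \int[mu]_y (r y ^+ m).
have D0 : 0 < D by apply: lt_le_trans Dc; exact: exprn_gt0.
have bm0 : 0 <= b ^+ m by rewrite exprn_ge0 // ltW.
have Dp : b ^+ m * p <= D.
  rewrite -(Rintegral_cst mu mO2) Rintegral_mkcond; apply: ae_le_Rintegral => //.
    apply: (@bounded_integrable _ _ _ _ _ (b ^+ m)).
      by apply: (measurable_restrictT _ mO2).1; exact: measurable_cst.
    by move=> y; rewrite patchE; case: ifPn => _; rewrite ?normr0 // ger0_norm.
  apply: ae_sub (support_ae Xmu_support).
  move=> y Xy; rewrite patchE; case: ifPn => O2y.
    by apply: expr_le; [exact: ltW|apply: kz2 => //; exact: set_mem].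
  by rewrite exprn_ge0.
set k' := fun y => (kappa z' y)%:C%C : R[i].
have mk' : cmeasurable (k' : borel X -> R[i]).
  exact/continuous_cmeasurable/continuousC/kappa_continuousl.
have k'B y : rnorm (k' y) <= Bk by rewrite rnormR ger0_norm // ltW.
have sg := wavg_square_integrable (mu := mu) m mg mk' gB k'B.
have s1 : square_integrable mu (fun y => k' y ^+ m * 1).
  apply: (wavg_square_integrable m _ mk' _ k'B (Bf := 1)); first exact: cmeasurable_cst.
  by move=> y; rewrite rnorm1.
have NE : wavg mu m g k' - f z' * wavg mu m (fun=> 1) k' =
    cintegral mu (fun y => k' y ^+ m * (g y - f z')).
  rewrite /wavg addrC -mulNr -(cintegral_linear (H := H)) //.
  by congr cintegral; apply/funext => y; ring.
have fz'B : rnorm (f z') <= Bf by rewrite -gE.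
have Nle : rnorm (wavg mu m g k' - f z' * wavg mu m (fun=> 1) k') <=
    2 * (e / 4 * D + 2 * Bf * a ^+ m).
  have irm' : mu.-integrable setT (EFin \o (fun y => e / 4 * r y ^+ m + 2 * Bf * a ^+ m)).
    apply: (@bounded_integrable _ _ _ _ _ (e / 4 * Bk ^+ m + 2 * Bf * a ^+ m)).
      apply: measurable_funD; last exact: measurable_cst.
      apply: measurable_funM; [exact: measurable_cst|exact: measurable_funX].
    have am : 0 <= 2 * Bf * a ^+ m by rewrite !mulr_ge0 ?exprn_ge0 // ltW.
    have e40 : 0 <= e / 4 by rewrite divr_ge0 ?ltW.
    move=> y; rewrite ger0_norm; last first.
      by rewrite addr_ge0 // mulr_ge0 // exprn_ge0 // ltW.
    by rewrite lerD2r ler_wpM2l // expr_le.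
  have -> : e / 4 * D + 2 * Bf * a ^+ m = \int[mu]_y (e / 4 * r y ^+ m + 2 * Bf * a ^+ m).
    rewrite RintegralD //; last 2 first.
    - have := integrableZl measurableT (e / 4) irm.
      by apply: eq_integrable => // y _; rewrite /= EFinM.
    - by apply: (@bounded_integrable _ _ _ _ _ `|2 * Bf * a ^+ m|) => //; exact: measurable_cst.
    rewrite RintegralZl // Rintegral_cst // [X in _ = _ + _ * X](_ : _ = 1) ?mulr1 //.
    exact: (congr1 fine (probability_setT mu)).
  rewrite NE; apply: (rnorm_cintegral_le (B := Bk ^+ m * (Bf + Bf))) => //.
  - apply: cmeasurableM; first exact: cmeasurableX.
    apply: (cmeasurableD mg); exact: cmeasurable_cst.
  - move=> y; rewrite rnormM rnormX ler_pM ?exprn_ge0 ?rnorm_ge0 //.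
      by rewrite expr_le ?rnorm_ge0.
    by apply: le_trans (rnormD _ _) _; rewrite rnormN lerD.
  apply: ae_sub (support_ae Xmu_support) => y Xy.
  rewrite rnormM rnormX rnormR ger0_norm; last by rewrite ltW.
  have rm0 : 0 <= r y ^+ m by rewrite exprn_ge0 // ltW.
  have am0 : 0 <= a ^+ m by rewrite exprn_ge0 // ltW.
  have [Oy|nOy] := pselect (W y).
    have h : rnorm (g y - f z') <= e / 4.
      rewrite gE //; apply: le_trans (rdistD (f z) _ _) _.
      have := fO _ Oy Xy; have := fO _ Oz' Xz'; rewrite (rdistC (f y)); lra.
    apply: (@le_trans _ _ (r y ^+ m * (e / 4))); first by rewrite ler_wpM2l.
    by rewrite mulrC lerDl; apply: mulr_ge0 => //; apply: mulr_ge0.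
  have h : rnorm (g y - f z') <= 2 * Bf.
    apply: le_trans (rnormD _ _) _; rewrite rnormN; have := gB y; lra.
  have h2 : r y ^+ m <= a ^+ m.
    by apply: expr_le => //; exact: kz1.
  apply: (@le_trans _ _ (a ^+ m * (2 * Bf))).
    by apply: ler_pM => //; exact: rnorm_ge0.
  by rewrite [leLHS]mulrC lerDr mulr_ge0 // divr_ge0 // ltW.
have DnE : wavg mu m (fun=> 1) k' = D%:C%C by exact: DE.
have Dn0 : wavg mu m (fun=> 1) k' != 0.
  by rewrite DnE; apply: rnorm_neq0 D0 _; rewrite rnormR ler_norm.
have -> : wratio mu m g k' - f z' =
    (wavg mu m g k' - f z' * wavg mu m (fun=> 1) k') / wavg mu m (fun=> 1) k'.
  by rewrite /wratio mulrBl mulfK.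
rewrite rnormM rnormV {2}DnE rnormR (ger0_norm (ltW D0)) ler_pdivrMr //.
apply: le_trans Nle _.
have h : 4 * Bf * a ^+ m <= e / 2 * D.
  apply: (@le_trans _ _ (e / 2 * (b ^+ m * p))); last by rewrite ler_wpM2l // ltW.
  have := ltW hm; rewrite expr_div_n.
  rewrite (_ : _ / p * _ = (4 * Bf * a ^+ m) / (b ^+ m * p)); last first.
    by field; rewrite !gt_eqF ?exprn_gt0.
  by rewrite ler_pdivrMr // mulr_gt0 ?exprn_gt0.
lra.
Qed.

End concentration.

(** * The limit of vanishing smoothing *)

Section majorants.
Context {R : realType} {d : measure_display} {T : measurableType d}.
Context {mu : probability T R} {H : L2space mu}.

Lemma cmeasurable_rnorm (f : T -> R[i]) :
  cmeasurable f -> measurable_fun setT (fun x => rnorm (f x)).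
Proof.
move=> mf; rewrite (_ : (fun _ => _) = Num.sqrt \o (fun x => rnorm (f x) ^+ 2)).
  apply: measurableT_comp; last exact: measurable_rnorm_sqr.
  by apply: continuous_measurable_fun; exact: sqrt_continuous.
by apply/funext => x /=; rewrite sqrtr_sqr ger0_norm ?rnorm_ge0.
Qed.

Lemma square_integrable_rnorm (f : T -> R[i]) :
  square_integrable mu f -> square_integrable mu (fun x => (rnorm (f x))%:C%C).
Proof.
move=> /square_integrableP[mf sf]; apply/square_integrableP; split.
  by apply: cmeasurableR; exact: cmeasurable_rnorm.
apply: eq_integrable sf => // x _ /=.
by rewrite rnormR ger0_norm ?rnorm_ge0.
Qed.

(** The majorant is itself a class in [H]: the triangle inequality applies to the moduli of the
    [g j], and the constant [e] has norm [e] because [mu] is a probability. *)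
Lemma rnorm_cls_le_sum (J : Type) (s : seq J) (g : J -> T -> R[i]) (h : T -> R[i]) (c e : R) :
  0 <= c -> 0 <= e -> square_integrable mu h ->
  (forall j, square_integrable mu (g j)) ->
  {ae mu, forall x, rnorm (h x) <= c * (\sum_(j <- s) rnorm (g j x) + e)} ->
  rnorm (cls H h) <= c * (\sum_(j <- s) rnorm (cls H (g j)) + e).
Proof.
move=> c0 e0 sh sg hle.
pose G (s : seq J) x := (\sum_(j <- s) rnorm (g j x) + e)%:C%C : R[i].
have [sG nG] : square_integrable mu (G s) /\
    rnorm (cls H (G s)) <= \sum_(j <- s) rnorm (cls H (g j)) + e.
  elim: {hle} s => [|j s [sG nG]].
    rewrite (_ : G [::] = fun=> e%:C%C); last by apply/funext => x; rewrite /G big_nil add0r.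
    by rewrite big_nil add0r rnorm_cls_cst //; split => //; exact: square_integrable_cst.
  have GE : G (j :: s) = fun x => 1 * (rnorm (g j x))%:C%C + G s x.
    by apply/funext => x; rewrite /G big_cons mul1r -addrA [in LHS]rmorphD.
  have sgj := square_integrable_rnorm (sg j).
  rewrite GE; split; first exact: square_integrableP2.
  rewrite cls_linear // scale1r big_cons -addrA; apply: le_trans (rnormD _ _) _.
  apply: lerD => //; apply: rnorm_cls_le => //.
  by apply: ae_all => x; rewrite rnormR ger0_norm ?rnorm_ge0.
apply: (@le_trans _ _ (rnorm (cls H (fun x => c%:C%C * G s x)))).
  apply: rnorm_cls_le => //; first exact: square_integrableZ.
  apply: ae_sub hle => x /le_trans; apply.
  by rewrite -rmorphM rnormR ler_norm.
by rewrite -clsZ // rnormZ rnormR ger0_norm // ler_wpM2l.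
Qed.

End majorants.

Lemma kernel_finite_net (R : realType) (X : ptopologicalType) (M : set X)
    (kappa : X -> X -> R) (e : R) : compact M -> continuous_kernel kappa -> 0 < e ->
  exists s : seq X, forall y, M y ->
    exists2 y', y' \in s & forall z, M z -> `|kappa z y - kappa z y'| < e.
Proof.
move=> cM ck e0.
have csw : continuous (fun p : X * X => kappa p.2 p.1).
  exact: (continuous_swap ck).
(* Interiors supply the open sets for the covering; each still contains its centre because [kappa]
   varies uniformly over [M]. *)
pose B y := (interior [set y' | forall z, M z -> `|kappa z y - kappa z y'| < e] : set X).
have := cM; rewrite compact_cover => /(_ X M B).
case=> [y _|y My|D _ Dcov]; first exact: open_interior.
  exists y => //; rewrite /B /interior /=.
  exact: (compact_unif_near (g := fun y z => kappa z y) y cM csw e0).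
exists (finmap.enum_fset D) => y My; have [y' Dy' /interior_subset /= yy'] := Dcov y My.
by exists y' => // z Mz; rewrite distrC; exact: yy'.
Qed.

(** * Averages of [kappa] against the kernels along the flow *)

Section smoothing_limit.
Context {R : realType} {X : ptopologicalType} {mu : probability (borel X) R}.
Context {H : L2space mu} {Xmu M : set X}.
Hypothesis Xmu_support : is_support mu Xmu.
Hypothesis Xmu_M : Xmu `<=` M.
Hypothesis M_compact : compact M.
Hypothesis X_hausdorff : hausdorff_space X.
Context {kappa : X -> X -> R}.
Hypothesis kappa_gt0 : forall x y, 0 < kappa x y.
Hypothesis kappa_bounded : bounded_kernel kappa.
Hypothesis kappa_continuous : continuous_kernel kappa.
Context {Phi : R -> X -> X} {U : R -> H -> H}.
Hypothesis Phi_flow : is_flow Phi.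
Hypothesis mu_invariant : invariant_measure mu Phi.
Hypothesis U_koopman : koopman Phi U.
Hypothesis U_group : unitary_group U.
Context {k : R -> X -> X -> R} {Hk : forall tau, rkhs (k tau)}.
Context {K : forall tau, H -> Hk tau}.
Hypothesis k_gt0 : forall tau x y, 0 < tau -> 0 < k tau x y.
Hypothesis k_bounded : forall tau, 0 < tau -> bounded_kernel (k tau).
Hypothesis k_continuous : forall tau, 0 < tau -> continuous_kernel (k tau).
Hypothesis K_integral : forall tau, 0 < tau -> is_integral_operator (K tau).
Hypothesis K_adjoint : forall tau, 0 < tau ->
  is_adjoint (K tau) (@rk_class _ _ _ H _ (Hk tau)).
Hypothesis K4 : forall f : H, Gop K tau f @[tau --> (0 : R)^'+] --> f.
Hypothesis k_markov : forall tau x, 0 < tau -> M x ->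
  cintegral mu (fun y => (k tau x y)%:C%C) = 1.

Lemma Phi_continuous t : continuous (Phi t).
Proof.
by have [_ _ cP] := Phi_flow; exact: continuous_partiall cP.
Qed.

Lemma Phi_measurable t : measurable_fun setT (Phi t : borel X -> borel X).
Proof.
apply: (@measurability _ _ (borel X) (borel X) setT (Phi t) (@open X)) => // _ [W oW <-].
rewrite setTI; apply: sub_sigma_algebra.
by apply: open_comp => // x _; exact: Phi_continuous.
Qed.

Lemma cmeasurable_Phi (f : X -> R[i]) t : cmeasurable (f : borel X -> R[i]) ->
  cmeasurable (f \o Phi t : borel X -> R[i]).
Proof.
move=> [f1 f2]; split; first exact: (measurableT_comp f1 (Phi_measurable t)).
exact: (measurableT_comp f2 (Phi_measurable t)).
Qed.

(** Invariance of [mu] keeps preimages of null sets null. As [M] is invariant only forward in time,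
    this is how [Phi t x] is known to lie in [M] for almost every [x] also when [t] is negative. *)
Lemma ae_Phi (P : X -> Prop) t : {ae mu, forall x : borel X, P x} ->
  {ae mu, forall x : borel X, P (Phi t x)}.
Proof.
move=> [N [mN N0 PN]]; exists (Phi t @^-1` N); split.
- rewrite -[_ @^-1` _]setTI; exact: Phi_measurable.
- by rewrite mu_invariant.
- by move=> x nP; apply: (PN (Phi t x)) => ?; exact: nP.
Qed.

(* Its inner product with [kappa_class y] is
   [int k_sigma(x, z) kappa(Phi^t z, y) dmu(z)]. *)
Definition section_orbit (t sigma : R) (x : X) : H :=
  U (- t) (rk_class H (rk_section (Hk sigma) x)).

(** Both [U (- t)] and the inclusion move to the other side as their adjoints, and the section then
    evaluates at [x]. The right-hand side is a representative of the class [Gop K sigma (U t v)]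
    defined at every point. *)
Lemma hdot_section_orbit t sigma x v : 0 < sigma ->
  hdot (section_orbit t sigma x) v = rk_eval (Hk sigma) (K sigma (U t v)) x.
Proof.
move=> s0; rewrite /section_orbit (unitaryV U_group) rk_reproducing.
by rewrite hdotC -K_adjoint // -hdotC.
Qed.

(* [M x] makes [k_sigma(x, .)] a probability density. *)
Lemma section_orbit_mean t sigma x (g : X -> R) (B lo hi : R) : 0 < sigma -> M x ->
  measurable_fun setT (g : borel X -> R) -> (forall z, `|g z| <= B) ->
  {ae mu, forall z : borel X, lo <= g z <= hi} ->
  exists2 a : R, hdot (section_orbit t sigma x) (cls H (fun z => (g z)%:C%C)) = a%:C%C &
    lo <= a <= hi.
Proof.
move=> s0 Mx mg gB glh.
have mgC : cmeasurable ((fun z => (g z)%:C%C) : borel X -> R[i]) by exact: cmeasurableR.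
have gCB z : rnorm ((g z)%:C%C : R[i]) <= B by rewrite rnormR.
have sg : square_integrable mu (fun z => (g z)%:C%C : R[i]).
  exact: (bounded_square_integrable mgC gCB).
have sgP : square_integrable mu ((fun z => (g z)%:C%C : R[i]) \o Phi t).
  by apply: (bounded_square_integrable (cmeasurable_Phi t mgC)) => z; exact: gCB.
have [Bk kB] := k_bounded s0.
have kB' z : `|k sigma x z| <= Bk by rewrite ger0_norm // ltW ?k_gt0.
have mk : measurable_fun setT (k sigma x : borel X -> R).
  by have [] := continuous_cmeasurable (continuousC (kappa_continuousl (k_continuous s0) (x := x))).
have ik : mu.-integrable setT (EFin \o (k sigma x : borel X -> R)).
  exact: (bounded_integrable mk kB').
have mgP : measurable_fun setT ((g \o Phi t) : borel X -> R).
  exact: (measurableT_comp mg (Phi_measurable t)).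
have ikg : mu.-integrable setT (EFin \o (fun z => k sigma x z * g (Phi t z))).
  apply: (@bounded_integrable _ _ _ _ _ (Bk * B)); first exact: measurable_funM.
  by move=> z; rewrite normrM ler_pM.
have k1 : \int[mu]_z k sigma x z = 1.
  by have := k_markov s0 Mx; rewrite cintegralR => /complexI.
exists (\int[mu]_z (k sigma x z * g (Phi t z))).
  rewrite hdot_section_orbit // U_koopman // K_integral // -cintegralR.
  by congr cintegral; apply/funext => z; rewrite rmorphM.
have cst r : r = \int[mu]_z (k sigma x z * r) by rewrite RintegralZr // k1 mul1r.
have ikr r : mu.-integrable setT (EFin \o (fun z => k sigma x z * r)).
  apply: (@bounded_integrable _ _ _ _ _ (Bk * `|r|)).
    by apply: measurable_funM => //; exact: measurable_cst.
  by move=> z; rewrite normrM ler_wpM2r.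
apply/andP; split.
  rewrite [leLHS]cst; apply: ae_le_Rintegral => //.
  by apply: ae_sub (ae_Phi t glh) => z /andP[lo_z _]; rewrite ler_pM2l // k_gt0.
rewrite [leRHS]cst; apply: ae_le_Rintegral => //.
by apply: ae_sub (ae_Phi t glh) => z /andP[_ z_hi]; rewrite ler_pM2l // k_gt0.
Qed.

(** The real-valued representative of [kappa_class], to which the order bounds of
    [section_orbit_mean] apply. *)
Let kM (y x : X) : R := patch (fun=> 0) M (kappa^~ y) x.

Let kM_measurable y : measurable_fun setT (kM y : borel X -> R).
Proof.
apply: (measurable_restrictT _ (closed_borel (M_closed M_compact X_hausdorff))).1.
apply: within_continuous_borel; first exact: M_closed.
by apply: continuous_subspaceT; exact: kappa_continuousr.
Qed.

Let kME y : patch (fun=> 0) M (fun x => (kappa x y)%:C%C : R[i]) = fun x => (kM y x)%:C%C.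
Proof. by apply/funext => x; rewrite /kM !patchE; case: ifPn. Qed.

Let kappa_classE y : kappa_class H M kappa y = cls H (fun x => (kM y x)%:C%C).
Proof. by rewrite /kappa_class /iotaM kME. Qed.

Let kM_square_integrable y : square_integrable mu (fun x => (kM y x)%:C%C : R[i]).
Proof.
rewrite -kME; apply: (patch_continuous_square_integrable Xmu_support Xmu_M M_compact X_hausdorff).
by apply: continuousC_within; exact: kappa_continuousr.
Qed.

Lemma section_orbit_kappa t sigma x y (B c : R) : 0 < sigma -> M x ->
  (forall x y, kappa x y <= B) -> (M y -> forall z, M z -> c <= kappa z y) ->
  exists2 a : R, hdot (section_orbit t sigma x) (kappa_class H M kappa y) = a%:C%C &
    0 <= a <= B /\ (M y -> c <= a).
Proof.
move=> s0 Mx kB cM.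
have kMB z : 0 <= kM y z <= B.
  rewrite /kM patchE; case: ifPn => _; first by rewrite kB ltW.
  by rewrite lexx (le_trans (ltW (kappa_gt0 point point)) (kB _ _)).
have kMB' z : `|kM y z| <= B by have /andP[h1 h2] := kMB z; rewrite ger0_norm.
have kM0 : {ae mu, forall z : borel X, 0 <= kM y z <= B} by exact: ae_all.
have [a aE aB] := section_orbit_mean t s0 Mx (kM_measurable y) kMB' kM0.
exists a; first by rewrite kappa_classE.
split => // My.
have kMc : {ae mu, forall z : borel X, c <= kM y z <= B}.
  apply: ae_sub (ae_M Xmu_support Xmu_M) => z Mz.
  have /andP[_ ->] := kMB z; rewrite andbT /kM patchE mem_set //.
  exact: cM.
(* The same inner product again, now with a lower bound that holds only almost everywhere;
   injectivity of the embedding of [R] in [R[i]] identifies the two real values. *)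
have [a' a'E /andP[ca' _]] := section_orbit_mean t s0 Mx (kM_measurable y) kMB' kMc.
by move: aE; rewrite a'E => /complexI <-.
Qed.

(** The difference of the two weights is a mean of [kappa z y - kappa z y']. Cauchy-Schwarz would
    instead bring in the norm of [section_orbit], for which no bound uniform in [sigma] is at
    hand. *)
Lemma section_orbit_kappa_dist t sigma x y y' (e : R) : 0 < sigma -> M x ->
  (forall z, M z -> `|kappa z y - kappa z y'| <= e) ->
  rnorm (hdot (section_orbit t sigma x) (kappa_class H M kappa y) -
         hdot (section_orbit t sigma x) (kappa_class H M kappa y')) <= e.
Proof.
move=> s0 Mx ke; have [x0 Mx0] := M_nonempty Xmu_support Xmu_M.
have e0 : 0 <= e by exact: le_trans (normr_ge0 _) (ke _ Mx0).
have kMe z : `|kM y z - kM y' z| <= e.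
  rewrite /kM !patchE; case: ifPn => [|_]; first by rewrite inE; exact: ke.
  by rewrite subrr normr0.
have kMe' z : - e <= kM y z - kM y' z <= e by rewrite -ler_norml.
have mkM : measurable_fun setT ((fun z => kM y z - kM y' z) : borel X -> R).
  exact: measurable_funB.
have kM0 : {ae mu, forall z : borel X, - e <= kM y z - kM y' z <= e} by exact: ae_all.
have [a aE ae] := section_orbit_mean t s0 Mx mkM kMe kM0.
rewrite -hdotBr !kappa_classE clsB; [|exact: kM_square_integrable..].
rewrite (_ : (fun _ => _) = fun z => (kM y z - kM y' z)%:C%C); last first.
  by apply/funext => z; rewrite rmorphB.
by rewrite aE rnormR ler_norml.
Qed.

Lemma section_orbit_continuous t sigma : 0 < sigma ->
  continuous (section_orbit t sigma).
Proof.
move=> s0 x; apply/cvg_rnormP => e e0.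
have c0 : 0 < rk_varpi (Hk sigma).
  exact: varpi_gt0 (k_bounded s0) _ (k_gt0 x x s0).
have ec0 : 0 < e / rk_varpi (Hk sigma) by rewrite divr_gt0.
have /cvg_rnormP/(_ _ ec0) := section_continuous (Hk := Hk sigma) (k_continuous s0) (x := x).
apply: filterS => y xy; rewrite /section_orbit (U_rnormB U_group).
rewrite -(rk_classB (k_bounded s0) (k_continuous s0)).
apply: le_lt_trans (rnorm_rk_class_le (k_bounded s0) (k_continuous s0) _) _.
by rewrite mulrC -ltr_pdivlMr.
Qed.

(** For [y] in [M] the weight is a mean of values of [kappa] on [M] times [M], so the [m]-th power
    of a positive lower bound of [kappa] there serves for all parameters. *)
Lemma wavg_orbit_lower m : exists2 c : R, 0 < c & forall sigma t x, 0 < sigma -> M x ->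
  c <= rnorm (wavg mu m (fun=> 1)
    (fun y => hdot (section_orbit t sigma x) (kappa_class H M kappa y))).
Proof.
have [c c0 cM] := compact_pos_lower M_compact kappa_continuous (fun p => kappa_gt0 p.1 p.2).
have [B kB] := kappa_bounded.
exists (c ^+ m) => [|sigma t x s0 Mx]; first exact: exprn_gt0.
pose r y := complex.Re (hdot (section_orbit t sigma x) (kappa_class H M kappa y)).
have cM' y : M y -> forall z, M z -> c <= kappa z y by move=> My z Mz; exact: cM.
have rE y : hdot (section_orbit t sigma x) (kappa_class H M kappa y) = (r y)%:C%C.
  by have [a aE _] := section_orbit_kappa t s0 Mx kB (cM' y); rewrite /r aE.
have rB y : 0 <= r y <= B.
  by have [a aE [aB _]] := section_orbit_kappa t s0 Mx kB (cM' y); rewrite /r aE.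
have rc y : M y -> c <= r y.
  have [a aE [_ ca]] := section_orbit_kappa t s0 Mx kB (cM' y).
  by rewrite /r aE.
have mr : measurable_fun setT (r : borel X -> R).
  by have [] := hdot_kappa_class_cmeasurable Xmu_support Xmu_M M_compact X_hausdorff
    kappa_continuous (section_orbit t sigma x).
have rae : {ae mu, forall y : borel X, c <= r y}.
  by apply: ae_sub (ae_M Xmu_support Xmu_M) => y; exact: rc.
have [DE cD] := wavg_lower m mr rB c0 rae.
under [X in wavg _ _ _ X]eq_fun do rewrite rE.
by rewrite DE rnormR (le_trans cD) // ler_norm.
Qed.

Definition orbit_ratio m (f : X -> R[i]) t sigma x : R[i] :=
  wratio mu m f (fun y => hdot (section_orbit t sigma x) (kappa_class H M kappa y)).

Lemma rnorm_orbit_kappa t sigma x y (B : R) : 0 < sigma -> M x ->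
  (forall x y, kappa x y <= B) ->
  rnorm (hdot (section_orbit t sigma x) (kappa_class H M kappa y)) <= B.
Proof.
move=> s0 Mx kB; have c0 : M y -> forall z, M z -> 0 <= kappa z y.
  by move=> _ z _; exact: ltW.
have [a -> [/andP[a0 aB] _]] := section_orbit_kappa t s0 Mx kB c0.
by rewrite rnormR ger0_norm.
Qed.

Lemma orbit_ratio_continuous m (f : X -> R[i]) t sigma (Bf : R) : 0 < sigma ->
  cmeasurable (f : borel X -> R[i]) -> (forall x, rnorm (f x) <= Bf) ->
  {within M, continuous (orbit_ratio m f t sigma)}.
Proof.
move=> s0 mf fB; have [c c0 clow] := wavg_orbit_lower m; have [B kB] := kappa_bounded.
have B0 : 0 < B by exact: lt_le_trans (kappa_gt0 point point) (kB _ _).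
apply: (wratio_within_continuous Xmu_support Xmu_M (H := H) (B := B) mf fB _ _ c0 _ _).1.
- by move=> x; exact: (hdot_kappa_class_cmeasurable Xmu_support Xmu_M M_compact
    X_hausdorff kappa_continuous).
- by move=> x y Mx; exact: rnorm_orbit_kappa.
- by move=> x Mx; exact: clow.
- move=> x e Mx e0; have eB : 0 < e / B by rewrite divr_gt0.
  have /cvg_rnormP/(_ _ eB) := section_orbit_continuous (t := t) s0 (x := x).
  apply: filterS => x' xx' _; apply: ae_all => y.
  rewrite -hdotBl; apply: le_trans (rnorm_hdot _ _) _.
  apply: (@le_trans _ _ (rnorm (section_orbit t sigma x - section_orbit t sigma x') * B)).
    rewrite ler_wpM2l ?rnorm_ge0 //; exact: (rnorm_kappa_class Xmu_support Xmu_M).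
  by rewrite -ler_pdivlMr // ltW.
Qed.

(** For almost every [x] the two quotients differ by at most [L] times the essential supremum over
    [y] of the difference of their weights. A finite net bounds this supremum by a function of [x]
    whose L^2 norm involves only the errors of [Gop K sigma] on finitely many fixed vectors. *)
Lemma smoothing_limit m (f : X -> R[i]) t : {within M, continuous f} ->
  rnorm (iotaM H M (orbit_ratio m (patch (fun=> 0) M f) t sigma) -
    U t (iotaM H M (fun z => wratio mu m (patch (fun=> 0) M f) (fun y => (kappa z y)%:C%C))))
    @[sigma --> (0 : R)^'+] --> (0 : R).
Proof.
move=> cf; set g := patch _ M f; set s := fun z => wratio _ _ _ _.
have mg : cmeasurable (g : borel X -> R[i]).
  exact: patch_cmeasurable (M_closed M_compact X_hausdorff) cf.
have [Bf Bf0 gB] := patch_bounded M_compact cf.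
have [B kB] := kappa_bounded.
have B0 : 0 < B by exact: lt_le_trans (kappa_gt0 point point) (kB _ _).
have [c1 c10 clow1] := wavg_orbit_lower m.
have [c2 c20 clow2] := wavg_kappa_lower Xmu_support Xmu_M M_compact kappa_gt0
  kappa_bounded kappa_continuous m.
pose c := Num.min c1 c2.
have c0 : 0 < c by rewrite lt_min c10.
have [L L0 lip] := wratio_lipschitz (mu := mu) (H := H) m (ltW B0) Bf0 c0.
have cs : {within M, continuous s}.
  exact: (wratio_kappa_continuous Xmu_support Xmu_M (H := H) M_compact kappa_gt0
    kappa_bounded kappa_continuous mg gB).
have sqs := patch_continuous_square_integrable Xmu_support Xmu_M M_compact X_hausdorff cs.
have sqsP : square_integrable mu (patch (fun=> 0) M s \o Phi t).
  have [Bs _ sB] := patch_bounded M_compact cs.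
  apply: (@bounded_square_integrable _ _ (borel X) mu _ Bs); last by move=> x; exact: sB.
  by apply: cmeasurable_Phi; exact: patch_cmeasurable (M_closed M_compact X_hausdorff) cs.
have kMP_sq y : square_integrable mu ((fun x => (kM y x)%:C%C : R[i]) \o Phi t).
  apply: (@bounded_square_integrable _ _ (borel X) mu _ B).
    by apply: cmeasurable_Phi; apply: cmeasurableR; exact: kM_measurable.
  move=> x /=; rewrite rnormR /kM patchE; case: ifPn => _.
    by rewrite ger0_norm // ltW.
  by rewrite normr0 ltW.
have dev_sq sigma y : 0 < sigma ->
    square_integrable mu (fun x => rk_eval (Hk sigma) (K sigma (U t (kappa_class H M kappa y))) x
      - (kM y (Phi t x))%:C%C).
  move=> s0; apply: (square_integrableB _ (kMP_sq y)).
  exact: (rk_eval_square_integrable (k_bounded s0) (k_continuous s0)).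
have dev_norm sigma y : 0 < sigma ->
    cls H (fun x => rk_eval (Hk sigma) (K sigma (U t (kappa_class H M kappa y))) x
      - (kM y (Phi t x))%:C%C) =
    Gop K sigma (U t (kappa_class H M kappa y)) - U t (kappa_class H M kappa y).
  move=> s0; have ukE : U t (kappa_class H M kappa y) = cls H ((fun x => (kM y x)%:C%C) \o Phi t).
    by rewrite kappa_classE U_koopman.
  rewrite GopE // [X in _ = _ - X]ukE /rk_class clsB //.
  exact: (rk_eval_square_integrable (k_bounded s0) (k_continuous s0)).
apply/cvgrPdist_lt => eps eps0.
(* The final bound is [L * (S + 2 * e)] with the net sum [S] below [e], hence less than
   [(L + 1) * (4 * e)], which is [eps]. *)
pose e := eps / (4 * (L + 1)).
have L10 : 0 < L + 1 by rewrite ltr_wpDl.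
have e0 : 0 < e by rewrite divr_gt0 // mulr_gt0.
have [net net_M] := kernel_finite_net M_compact kappa_continuous e0.
have near_sum : \forall sigma \near (0 : R)^'+,
    \sum_(y <- net) rnorm (U t (kappa_class H M kappa y) -
       Gop K sigma (U t (kappa_class H M kappa y))) < e.
  have sum_cvg : \sum_(y <- net) rnorm (U t (kappa_class H M kappa y) -
       Gop K sigma (U t (kappa_class H M kappa y))) @[sigma --> (0 : R)^'+] --> (0 : R).
    elim: {net_M} net => [|y net IH].
      by under eq_fun do rewrite big_nil; exact: cvg_cst.
    under eq_fun do rewrite big_cons.
    have G_cvg : rnorm (U t (kappa_class H M kappa y) -
       Gop K sigma (U t (kappa_class H M kappa y))) @[sigma --> (0 : R)^'+] --> (0 : R).
      by apply/cvg_rnorm0P; exact: K4.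
    by have := cvgD G_cvg IH; rewrite addr0; apply.
  have /cvgrPdist_lt/(_ _ e0) := sum_cvg; apply: filterS => sigma.
  by rewrite sub0r normrN; apply: le_lt_trans; exact: ler_norm.
have sigma_gt0 : \forall sigma \near (0 : R)^'+, 0 < sigma by exact: nbhs_right_gt.
apply: filterS2 near_sum sigma_gt0 => sigma sum_e s0.
rewrite sub0r normrN ger0_norm ?rnorm_ge0 //.
have sqr := patch_continuous_square_integrable Xmu_support Xmu_M M_compact X_hausdorff
  (orbit_ratio_continuous (m := m) (t := t) s0 mg gB).
rewrite /iotaM (U_koopman t sqs) (clsB sqr sqsP).
apply: (@le_lt_trans _ _ (L * (\sum_(y <- net) rnorm (cls H
  (fun x => rk_eval (Hk sigma) (K sigma (U t (kappa_class H M kappa y))) x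
      - (kM y (Phi t x))%:C%C)) + 2 * e))).
  apply: rnorm_cls_le_sum => //.
  - by rewrite mulr_ge0 // ltW.
  - exact: (square_integrableB sqr sqsP).
  - by move=> y; exact: dev_sq.
  have Mae := ae_M Xmu_support Xmu_M.
  (* Both quotients are set to 0 off [M], so [x] and [Phi t x] must lie in [M] together. *)
  apply: ae_sub (ae_and Mae (ae_Phi t Mae)) => x [Mx MPx].
  have -> : patch (fun=> 0) M (orbit_ratio m g t sigma) x = wratio mu m g
      (fun y => hdot (section_orbit t sigma x) (kappa_class H M kappa y)).
    by rewrite patchE (mem_set Mx).
  have -> : (patch (fun=> 0) M s \o Phi t) x = wratio mu m g (fun y => (kappa (Phi t x) y)%:C%C).
    by rewrite [LHS]patchE (mem_set MPx).
  apply: lip.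
  - exact: mg.
  - exact: (hdot_kappa_class_cmeasurable Xmu_support Xmu_M M_compact X_hausdorff kappa_continuous).
  - exact/continuous_cmeasurable/continuousC/kappa_continuousl.
  - exact: gB.
  - by move=> y; exact: rnorm_orbit_kappa.
  - by move=> y; rewrite rnormR ger0_norm // ltW.
  - apply: addr_ge0; last by rewrite mulr_ge0 // ltW.
    by apply: sumr_ge0 => y _; exact: rnorm_ge0.
  (* Passing from [y] to the net point [y'] costs [e] in each of the two weights; the error at [y']
     is one term of the sum. *)
  - apply: ae_sub Mae => y My; have [y' y'net yy'] := net_M y My.
    apply: (@le_trans _ _ (e + rnorm (hdot (section_orbit t sigma x) (kappa_class H M kappa y')
       - (kappa (Phi t x) y')%:C%C) + e)).
      apply: le_trans (rdistD (hdot (section_orbit t sigma x) (kappa_class H M kappa y')) _ _) _.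
      rewrite -addrA; apply: lerD.
        by apply: section_orbit_kappa_dist => // z Mz; exact/ltW/yy'.
      apply: le_trans (rdistD ((kappa (Phi t x) y')%:C%C) _ _) _.
      by rewrite lerD2l -rmorphB rnormR distrC ltW // yy'.
    set T := rnorm (_ - _ : R[i]); set S := \sum_(j <- net) _.
    have TS : T <= S.
      rewrite /S (big_rem y') //= /T hdot_section_orbit // /kM patchE mem_set //.
      by rewrite lerDl sumr_ge0 // => j _; exact: rnorm_ge0.
    by rewrite mulr_natl mulr2n addrA (addrC e) lerD2r lerD2r.
  - by rewrite (le_trans _ (clow1 _ _ _ s0 Mx)) // ge_min lexx.
  - by rewrite (le_trans _ (clow2 _ MPx)) // ge_min lexx orbT.
under eq_bigr => y _ do rewrite dev_norm // rdistC.
apply: (@lt_le_trans _ _ ((L + 1) * (4 * e))).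
  have h : 0 <= \sum_(y <- net) rnorm (U t (kappa_class H M kappa y) -
       Gop K sigma (U t (kappa_class H M kappa y))) by apply: sumr_ge0 => y _; exact: rnorm_ge0.
  nra.
rewrite /e le_eqVlt; apply/orP; left; apply/eqP; field.
by rewrite gt_eqF.
Qed.

End smoothing_limit.

Arguments section_orbit {R X mu H} U {k} Hk t sigma x.
Arguments orbit_ratio {R X mu H} M kappa U {k} Hk m f t sigma x.

(** * The limit of vanishing regularization *)

Section orthogonal_projection.
Context {R : realType} {H : hilbertType R}.

Lemma rnorm_le_hdot (u v : H) : hdot v v = hdot v u -> rnorm v <= rnorm u.
Proof.
move=> vu; have [->|v0] := eqVneq (rnorm v) 0; first exact: rnorm_ge0.
have vpos : 0 < rnorm v by rewrite lt_neqAle eq_sym v0 rnorm_ge0.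
rewrite -(ler_pM2l vpos) -expr2; apply: le_trans (rnorm_hdot v u).
by rewrite -vu hdot_rnorm rnormR ler_norm.
Qed.

Lemma projection_le (S : set H) x p :
  is_orthogonal_projection S x p -> rnorm p <= rnorm x.
Proof.
move=> [Sp orth]; apply: rnorm_le_hdot; apply/eqP.
by rewrite eq_sym -subr_eq0 -hdotBr orth.
Qed.

(** Each residual is orthogonal to both [p] and [p'], so [p - p'] is orthogonal to the difference of
    the residuals. *)
Lemma projection_dist (S : set H) x x' p p' :
  is_orthogonal_projection S x p -> is_orthogonal_projection S x' p' ->
  rnorm (p - p') <= rnorm (x - x').
Proof.
move=> [Sp orth] [Sp' orth']; apply: rnorm_le_hdot; apply/eqP.
rewrite eq_sym -subr_eq0 -hdotBr (_ : _ - (p - p') = (x - p) - (x' - p')).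
  by rewrite hdotBr !hdotBl !orth // !orth' // !subrr.
by rewrite !opprB addrACA [RHS]addrACA (addrC (- p)).
Qed.

End orthogonal_projection.

(** * Kernel features evolved by the regularized groups *)

Section feature_orbit.
Context {R : realType} {X : ptopologicalType} {mu : probability (borel X) R}.
Context {H : L2space mu} {Xmu : set X}.
Hypothesis Xmu_support : is_support mu Xmu.
Context {U : R -> H -> H}.
Hypothesis U_group : unitary_group U.
Context {k : R -> X -> X -> R} {Hk : forall tau, rkhs (k tau)}.
Context {K : forall tau, H -> Hk tau}.
Hypothesis k_bounded : forall tau, 0 < tau -> bounded_kernel (k tau).
Hypothesis k_continuous : forall tau, 0 < tau -> continuous_kernel (k tau).
Hypothesis K_adjoint : forall tau, 0 < tau ->
  is_adjoint (K tau) (@rk_class _ _ _ H _ (Hk tau)).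
Hypothesis K3 : forall tau tau' (f : H), 0 <= tau -> 0 <= tau' ->
  Gop K tau (Gop K tau' f) = Gop K (tau + tau') f.
Hypothesis Hk_nested : forall tau sigma (h : Hk sigma), 0 < tau -> tau <= sigma ->
  exists2 g : Hk tau, rk_eval (Hk tau) g = rk_eval (Hk sigma) h & hnorm g <= hnorm h.
Context {Ureg : forall tau, R -> Hk tau -> Hk tau}.
Hypothesis Ureg_group : forall tau, 0 < tau -> unitary_group (@Ureg tau).
Hypothesis Ureg_cvg : forall (tau0 : R) (f : Hk tau0) (t : R), 0 < tau0 ->
  hnorm (rk_class H (@Ureg tau t (rk_incl (Hk tau0) (Hk tau) f)) - U t (rk_class H f))
    @[tau --> (0 : R)^'+] --> (0 : R).
Context {phi_mu : forall sigma, X -> Hk sigma}.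
Hypothesis phi_mu_projection : forall (sigma : R) (x : X), 0 < sigma ->
  is_orthogonal_projection (rk_sub (Hk sigma) Xmu)
    (rk_section (Hk sigma) x) (phi_mu sigma x).

Lemma rk_inclE tau sigma (h : Hk sigma) : 0 < tau -> tau <= sigma ->
  rk_eval (Hk tau) (rk_incl (Hk sigma) (Hk tau) h) = rk_eval (Hk sigma) h.
Proof.
move=> t0 ts; have [g gh _] := Hk_nested h t0 ts.
by rewrite /rk_incl; case: xgetP => [y _ //|/(_ g)].
Qed.

(** [rk_incl] is defined by choice, so its additivity is recovered from [rk_inj]: the copy of
    [h - h'] in [Hk tau] has the same values as the difference of the copies. *)
Lemma rk_incl_dist tau sigma (h h' : Hk sigma) : 0 < tau -> tau <= sigma ->
  rnorm (rk_incl (Hk sigma) (Hk tau) h - rk_incl (Hk sigma) (Hk tau) h') <= rnorm (h - h').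
Proof.
move=> t0 ts; have [g gh gle] := Hk_nested (h - h') t0 ts.
rewrite (_ : _ - _ = g); first exact: gle.
apply: rk_inj; apply/funext => x.
by rewrite rk_evalB !rk_inclE // gh rk_evalB.
Qed.

(** The residual of the projection is orthogonal to the sections at points of the support, which by
    the reproducing property means that it vanishes there. *)
Lemma rk_class_phi_mu sigma x : 0 < sigma ->
  rk_class H (phi_mu sigma x) = rk_class H (rk_section (Hk sigma) x).
Proof.
move=> s0; have [_ orth] := phi_mu_projection x s0.
apply: cls_ae; try exact: (rk_eval_square_integrable (k_bounded s0) (k_continuous s0)).
apply: ae_sub (support_ae Xmu_support) => z Xz.
rewrite !rk_reproducing; apply/eqP; rewrite eq_sym -subr_eq0 -hdotBr orth //.
apply: subset_closure; exists 1%N, (fun=> 1), (fun=> rk_section (Hk sigma) z).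
by split; [move=> _; exists z|rewrite big_ord_recl big_ord0 scale1r addr0].
Qed.

Definition feature_orbit t sigma tau (x : X) : H :=
  rk_class H (@Ureg tau (- t) (rk_incl (Hk sigma) (Hk tau) (phi_mu sigma x))).

(** Projection, inclusion, unitary evolution and the passage to classes all do not increase
    distances. The bound is free of [tau], which is the equicontinuity that [feature_orbit_cvg]
    rests on. *)
Lemma feature_orbit_dist t sigma tau x x' : 0 < tau -> tau <= sigma ->
  rnorm (feature_orbit t sigma tau x - feature_orbit t sigma tau x') <=
  rnorm (rk_section (Hk sigma) x - rk_section (Hk sigma) x').
Proof.
move=> t0 ts; have s0 : 0 < sigma by exact: lt_le_trans ts.
rewrite /feature_orbit -(rk_classB (k_bounded t0) (k_continuous t0)).
apply: le_trans (rk_class_contraction k_bounded k_continuous K_adjoint K3 Hk_nested _ t0) _.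
have [Ug _ _ _] := Ureg_group t0; have [Uiso _] := Ug (- t); have [Ulin _] := Uiso.
rewrite -is_linearB // isometry_rnorm //.
apply: le_trans (rk_incl_dist _ _ t0 ts) _.
exact: (projection_dist (phi_mu_projection x s0) (phi_mu_projection x' s0)).
Qed.

Lemma section_orbit_dist t sigma x x' : 0 < sigma ->
  rnorm (section_orbit U Hk t sigma x - section_orbit U Hk t sigma x') <=
  rnorm (rk_section (Hk sigma) x - rk_section (Hk sigma) x').
Proof.
move=> s0; rewrite /section_orbit U_rnormB //.
rewrite -(rk_classB (k_bounded s0) (k_continuous s0)).
exact: (rk_class_contraction k_bounded k_continuous K_adjoint K3 Hk_nested _ s0).
Qed.

Lemma rnorm_section_orbit t sigma x : 0 < sigma ->
  rnorm (section_orbit U Hk t sigma x) <= rk_varpi (Hk sigma).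
Proof.
move=> s0; rewrite /section_orbit U_rnorm //.
apply: le_trans (rnorm_section_le (k_bounded s0) x).
exact: (rk_class_contraction k_bounded k_continuous K_adjoint K3 Hk_nested _ s0).
Qed.

Lemma feature_orbit_continuous t sigma tau : 0 < tau -> tau <= sigma ->
  continuous (feature_orbit t sigma tau).
Proof.
move=> t0 ts x; have s0 : 0 < sigma by exact: lt_le_trans ts.
apply/cvg_rnormP => e e0.
have /cvg_rnormP/(_ _ e0) := section_continuous (Hk := Hk sigma) (k_continuous s0) (x := x).
apply: filterS => y; apply: le_lt_trans; exact: feature_orbit_dist.
Qed.

(** An [e / 3] argument: convergence at one point [x], and equicontinuity of both sides to pass to
    points near [x]; compactness of [M] then gives a common range of [tau]. *)
Lemma feature_orbit_cvg (M : set X) t sigma (e : R) : compact M -> 0 < sigma -> 0 < e ->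
  \forall tau \near (0 : R)^'+, forall x, M x ->
    rnorm (section_orbit U Hk t sigma x - feature_orbit t sigma tau x) < e.
Proof.
move=> /compact_near_coveringP cM s0 e0.
apply: (cM _ _ (fun tau x =>
  rnorm (section_orbit U Hk t sigma x - feature_orbit t sigma tau x) < e)) => x Mx.
have e3 : 0 < e / 3 by rewrite divr_gt0.
have near_x : \forall x' \near x,
    rnorm (rk_section (Hk sigma) x - rk_section (Hk sigma) x') < e / 3.
  by have /cvg_rnormP := section_continuous (Hk := Hk sigma) (k_continuous s0) (x := x); apply.
have near_tau : \forall tau \near (0 : R)^'+,
    [/\ rnorm (section_orbit U Hk t sigma x - feature_orbit t sigma tau x) < e / 3,
      0 < tau & tau <= sigma].
  have /cvgrPdist_lt/(_ _ e3) := Ureg_cvg (phi_mu sigma x) (- t) s0.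
  apply: filterS3 (nbhs_right_gt 0) (nbhs_right_le s0) => tau t0 ts.
  rewrite sub0r normrN rk_class_phi_mu // => h; split => //.
  by rewrite rdistC; apply: le_lt_trans h; exact: ler_norm.
exists ([set x' | rnorm (rk_section (Hk sigma) x - rk_section (Hk sigma) x') < e / 3],
  [set tau | [/\ rnorm (section_orbit U Hk t sigma x - feature_orbit t sigma tau x) < e / 3,
      0 < tau & tau <= sigma]]) => //.
move=> [x' tau] /= [xx' [qx t0 ts]].
apply: le_lt_trans (rdistD (section_orbit U Hk t sigma x) _ _) _.
have h1 := section_orbit_dist t x' x s0.
have h2 := rdistD (feature_orbit t sigma tau x) (section_orbit U Hk t sigma x) (feature_orbit t sigma tau x').
have h3 := feature_orbit_dist t x x' t0 ts.
rewrite (rdistC (rk_section _ x')) in h1.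
lra.
Qed.

End feature_orbit.

Arguments feature_orbit {R X mu} H {k Hk} Ureg phi_mu t sigma tau x.

(** * Stability of the quotients under uniform convergence of the weight vectors *)

Section noise_limit.
Context {R : realType} {X : ptopologicalType} {mu : probability (borel X) R}.
Context {H : L2space mu} {Xmu M : set X}.
Hypothesis Xmu_support : is_support mu Xmu.
Hypothesis Xmu_M : Xmu `<=` M.
Hypothesis M_compact : compact M.
Hypothesis X_hausdorff : hausdorff_space X.
Context {kappa : X -> X -> R}.
Hypothesis kappa_gt0 : forall x y, 0 < kappa x y.
Hypothesis kappa_bounded : bounded_kernel kappa.
Hypothesis kappa_continuous : continuous_kernel kappa.

(** With [q] the map [section_orbit] this unfolds to [orbit_ratio]; with [feature_orbit] it is the
    predictor at positive [tau]. *)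
Definition orbit_wratio m (f : X -> R[i]) (q : X -> H) (x : X) : R[i] :=
  wratio mu m f (fun y => hdot (q x) (kappa_class H M kappa y)).

Lemma orbit_wratio_square_integrable m (f : X -> R[i]) (q : X -> H) (Bf L c : R) :
  cmeasurable (f : borel X -> R[i]) -> (forall x, rnorm (f x) <= Bf) ->
  continuous q -> (forall x, M x -> rnorm (q x) <= L) -> 0 < c ->
  (forall x, M x -> c <= rnorm (wavg mu m (fun=> 1)
     (fun y => hdot (q x) (kappa_class H M kappa y)))) ->
  square_integrable mu (patch (fun=> 0) M (orbit_wratio m f q)).
Proof.
move=> mf fB cq qL c0 clow; have [B kB] := kappa_bounded.
have B0 : 0 < B by exact: lt_le_trans (kappa_gt0 point point) (kB _ _).
have kcB y := rnorm_kappa_class (H := H) Xmu_support Xmu_M M_compact X_hausdorff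
  kappa_gt0 kappa_continuous y kB.
apply: (patch_continuous_square_integrable Xmu_support Xmu_M M_compact X_hausdorff).
apply: (wratio_within_continuous Xmu_support Xmu_M (H := H) (B := L * B) mf fB _ _ c0 clow _).1.
- by move=> x; exact: (hdot_kappa_class_cmeasurable Xmu_support Xmu_M M_compact
    X_hausdorff kappa_continuous).
- move=> x y Mx; apply: le_trans (rnorm_hdot _ _) _.
  by apply: ler_pM; rewrite ?rnorm_ge0 ?qL.
- move=> x e Mx e0; have eB : 0 < e / B by rewrite divr_gt0.
  have /cvg_rnormP/(_ _ eB) := cq x.
  apply: filterS => x' xx' _; apply: ae_all => y.
  rewrite -hdotBl; apply: le_trans (rnorm_hdot _ _) _.
  apply: (@le_trans _ _ (rnorm (q x - q x') * B)); first by rewrite ler_wpM2l ?rnorm_ge0.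
  by rewrite -ler_pdivlMr // ltW.
Qed.

Lemma orbit_wratio_cvg m (f : X -> R[i]) (q : R -> X -> H) (q0 : X -> H) (Bf L c : R) :
  cmeasurable (f : borel X -> R[i]) -> (forall x, rnorm (f x) <= Bf) ->
  continuous q0 -> (\forall tau \near (0 : R)^'+, continuous (q tau)) ->
  (forall x, M x -> rnorm (q0 x) <= L) -> 0 < c ->
  (forall x, M x -> c <= rnorm (wavg mu m (fun=> 1)
     (fun y => hdot (q0 x) (kappa_class H M kappa y)))) ->
  (forall e : R, 0 < e -> \forall tau \near (0 : R)^'+, forall x, M x ->
     rnorm (q0 x - q tau x) < e) ->
  iotaM H M (orbit_wratio m f (q tau)) @[tau --> (0 : R)^'+] --> iotaM H M (orbit_wratio m f q0).
Proof.
move=> mf fB cq0 cq qL c0 clow q_cvg; have [B kB] := kappa_bounded.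
have B0 : 0 < B by exact: lt_le_trans (kappa_gt0 point point) (kB _ _).
have kcB y := rnorm_kappa_class (H := H) Xmu_support Xmu_M M_compact X_hausdorff
  kappa_gt0 kappa_continuous y kB.
have [x0 Mx0] := M_nonempty Xmu_support Xmu_M.
have L0 : 0 <= L by exact: le_trans (rnorm_ge0 _) (qL _ Mx0).
have Bf0 : 0 <= Bf by exact: le_trans (rnorm_ge0 _) (fB point).
(* Once [q tau] is within 1 of [q0] its norm is at most [L + 1], which gives a common bound for the
   weights; likewise [c / 2] will bound both denominators from below. *)
have C0 : 0 <= (L + 1) * B by rewrite mulr_ge0 ?addr_ge0 // ltW.
have c20 : 0 < c / 2 by rewrite divr_gt0.
have c2c : c / 2 <= c by rewrite ler_pdivrMr //; lra.
have [K1 K10 lip1] := wavg_lipschitz (mu := mu) (H := H) m C0 (ler01 : 0 <= 1 :> R).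
have [K2 K20 lip2] := wratio_lipschitz (mu := mu) (H := H) m C0 Bf0 c20.
have m1 : cmeasurable ((fun=> 1) : borel X -> R[i]) by exact: cmeasurable_cst.
have b1 (x : borel X) : rnorm (1 : R[i]) <= 1 by rewrite rnorm1.
have hm (u : H) := hdot_kappa_class_cmeasurable (H := H) Xmu_support Xmu_M M_compact
    X_hausdorff kappa_continuous u.
have hB (u : H) y : rnorm u <= L + 1 -> rnorm (hdot u (kappa_class H M kappa y)) <= (L + 1) * B.
  move=> uL; apply: le_trans (rnorm_hdot _ _) _.
  by apply: ler_pM; rewrite ?rnorm_ge0.
apply/cvg_rnormP => e e0.
(* Closeness [d1] lets the denominator drop by at most [c / 2], and [d2] keeps the quotients within
   [e / 2]. The added 1 guards against a vanishing Lipschitz constant. *)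
pose d1 : R := c / 2 / ((K1 + 1) * B).
pose d2 : R := e / 2 / ((K2 + 1) * B).
have K1B : 0 < (K1 + 1) * B by rewrite mulr_gt0 // ltr_wpDl.
have K2B : 0 < (K2 + 1) * B by rewrite mulr_gt0 // ltr_wpDl.
pose de := Num.min 1 (Num.min d1 d2).
have de0 : 0 < de by rewrite !lt_min ltr01 !divr_gt0.
have de1 : de <= 1 by rewrite ge_min lexx.
have ded1 : de <= d1 by rewrite !ge_min lexx !orbT.
have ded2 : de <= d2 by rewrite !ge_min lexx !orbT.
apply: filterS2 cq (q_cvg de de0) => tau cqt near_q.
have qtL x : M x -> rnorm (q tau x) <= L + 1.
  move=> Mx; have := rnormB_le (q tau x) (q0 x); rewrite rdistC.
  have := near_q x Mx; have := qL x Mx; rewrite ler_norml.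
  by move: de1; clear => ? ? ? /andP[? ?]; lra.
have q0L x : M x -> rnorm (q0 x) <= L + 1 by move=> Mx; rewrite (le_trans (qL x Mx)) // lerDl.
have hdist x : M x -> {ae mu, forall y : borel X,
    rnorm (hdot (q0 x) (kappa_class H M kappa y) - hdot (q tau x) (kappa_class H M kappa y)) <= de * B}.
  move=> Mx; apply: ae_all => y; rewrite -hdotBl; apply: le_trans (rnorm_hdot _ _) _.
  by apply: ler_pM; rewrite ?rnorm_ge0 // ltW // near_q.
have deB : 0 <= de * B by rewrite mulr_ge0 // ltW.
have clowt x : M x -> c / 2 <= rnorm (wavg mu m (fun=> 1)
     (fun y => hdot (q tau x) (kappa_class H M kappa y))).
  move=> Mx; have := lip1 _ _ _ _ m1 (hm (q0 x)) (hm (q tau x)) b1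
    (fun y => hB _ y (q0L x Mx)) (fun y => hB _ y (qtL x Mx)) deB (hdist x Mx).
  have h1 : K1 * (de * B) <= c / 2.
    apply: (@le_trans _ _ ((K1 + 1) * B * d1)); last by rewrite /d1 mulrC divfK ?gt_eqF.
    rewrite mulrA (mulrAC K1) mulrC (mulrC ((K1 + 1) * B)).
    apply: ler_pM; rewrite ?(ltW de0) ?mulr_ge0 // ?(ltW B0) //.
    by rewrite ler_wpM2r ?(ltW B0) // lerDl.
  have := clow x Mx; move: (wavg _ _ _ _) (wavg _ _ _ _) => D' D cD h2.
  have := rnormB_le D D'; rewrite ler_norml; move: h1 cD h2.
  by clear => ? ? ? /andP[_ ?]; lra.
have s0 := orbit_wratio_square_integrable mf fB cq0 qL c0 clow.
have st := orbit_wratio_square_integrable mf fB cqt qtL c20 clowt.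
apply: (@le_lt_trans _ _ (e / 2)); last first.
  by rewrite ltr_pdivrMr // mulr_natr mulr2n ltrDl.
apply: (rnorm_iotaM_dist (H := H) Xmu_support Xmu_M s0 st); first by rewrite divr_ge0 // ltW.
move=> x /Xmu_M Mx; rewrite /orbit_wratio.
apply: le_trans (lip2 _ _ _ _ mf (hm (q0 x)) (hm (q tau x)) fB
    (fun y => hB _ y (q0L x Mx)) (fun y => hB _ y (qtL x Mx)) deB (hdist x Mx)
    (le_trans c2c (clow x Mx)) (clowt x Mx)) _.
apply: (@le_trans _ _ ((K2 + 1) * B * d2)); last by rewrite /d2 mulrC divfK ?gt_eqF.
rewrite mulrA (mulrAC K2) mulrC (mulrC ((K2 + 1) * B)).
apply: ler_pM; rewrite ?(ltW de0) ?mulr_ge0 // ?(ltW B0) //.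
by rewrite ler_wpM2r ?(ltW B0) // lerDl.
Qed.

End noise_limit.

Arguments orbit_wratio {R X mu H} M kappa m f q x.

(** * The prediction formula *)

(* The feature [sum_n w(n)^-2 c^-n h^(v n)] reads off the degree-[m] tensor
   [(v y)^(v m)] as the [m]-th power of an inner product, and the factor
   [c^-m] cancels in the quotient. *)
Lemma prediction_wratio (R : realType) (X : ptopologicalType)
    (mu : probability (borel X) R) (L2 : L2space mu) (w : nat -> R)
    (H1 H2 : hilbertType R)
    (F1 : fock_algebra w H1) (F2 : fock_algebra w H2) (A : H1 -> H2) (J : F1 -> F2)
    (V : H2 -> H2) (VF : F2 -> F2) (flow : spectrum F2 -> spectrum F2)
    (m : nat) (v : X -> H2) (g : X -> R[i]) (ag a1 : F2)
    (phi : X -> spectrum F2) (c : R) (h : H1) (x : X) :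
  fock_weight w -> fock_lift A J -> unitary_op VF -> fock_lift V VF ->
  is_induced_flow VF flow ->
  is_weak_integral mu (fun y => vpow F2 m (v y)) g ag ->
  is_weak_integral mu (fun y => vpow F2 m (v y)) (fun=> 1) a1 ->
  0 < c -> rnorm h <= c ->
  (forall a, phi x a = hdot (J (fock_feature F1 c h)) a) ->
  square_integrable mu (fun y => hdot (A h) (V (v y)) ^+ m * g y) ->
  square_integrable mu (fun y => hdot (A h) (V (v y)) ^+ m * 1) ->
  prediction flow ag a1 phi x = wratio mu m g (fun y => hdot (A h) (V (v y))).
Proof.
move=> w_weight AJ [[_ VFiso] VFsurj] [_ _ VFvee] flowE wg w1 c0 hc phiE sg s1.
have evalE (u : X -> R[i]) (a : F2) :
    is_weak_integral mu (fun y => vpow F2 m (v y)) u a ->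
    square_integrable mu (fun y => hdot (A h) (V (v y)) ^+ m * u y) ->
    evolved_observable flow a (phi x) =
    ((c^-1)%:C%C) ^+ m * wavg mu m u (fun y => hdot (A h) (V (v y))).
  move=> wa su; rewrite /evolved_observable /gelfand /= flowE phiE.
  (* The weak integral can be tested only against a vector facing [a] itself. Writing the feature as
     [VF b] strips [VF] from both sides; after the test it is restored inside the integral, where it
     acts on the tensor powers. *)
  have [b _ bE] := VFsurj (J (fock_feature F1 c h)) I.
  rewrite -bE VFiso wa /wavg.
  have s0 : square_integrable mu (fun=> 0 : R[i]) by exact: square_integrable_cst.
  rewrite -[RHS]addr0 -[X in _ = _ + X](_ : cintegral mu (fun=> 0) = 0); last first.
    by rewrite (cintegral_dot (H := L2)) // cls0 hdot0r.
  rewrite -(cintegral_linear (H := L2)) //; congr cintegral; apply/funext => y.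
  rewrite addr0 -VFiso bE /vpow VFvee -/(vpow F2 m (V (v y))).
  by rewrite (hdot_lift_fock_feature w_weight m _ AJ c0 hc) exprMn mulrA.
have cm0 : ((c^-1)%:C%C : R[i]) ^+ m != 0.
  by rewrite expf_neq0 // fmorph_eq0 invr_eq0 gt_eqF.
(* The common nonzero factor cancels whether or not the denominator vanishes, division by 0 being 0
   on both sides. *)
rewrite /prediction (evalE _ _ wg sg) (evalE _ _ w1 s1) /wratio.
by rewrite -mulf_div divff // mul1r.
Qed.

(** * The iterated limit *)

Theorem theorem6 (R : realType) (X : ptopologicalType)
  (* flow, ergodic measure, support, manifold, vector field *)
  (Phi : R -> X -> X) (mu : probability (borel X) R) (Xmu M : set X)
  (d : nat) (I : Type) (c : I -> chart R X d) (v : I -> X -> 'rV[R]_d)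
  (X_metrizable : metrizable R X)
  (Phi_flow : is_flow Phi)
  (mu_invariant : invariant_measure mu Phi)
  (mu_ergodic : ergodic mu Phi)
  (Xmu_support : is_support mu Xmu) (Xmu_compact : compact Xmu)
  (Xmu_M : Xmu `<=` M) (M_compact : compact M)
  (M_C1 : C1_atlas c M)
  (M_forward_invariant : forall t : R, 0 <= t -> Phi t @` M `<=` M)
  (v_field : vector_field c v)
  (* Koopman group on H = L^2(mu) and its generator *)
  (H : L2space mu) (U : R -> H -> H) (V : operator H)
  (U_koopman : koopman Phi U) (U_group : unitary_group U)
  (V_generator : is_generator U V) (V_skew : skew_adjoint V)
  (V_field : generated_by_vector_field c v M V)
  (* kernels, RKHSs, integral operators *)
  (k : R -> X -> X -> R) (Hk : forall tau : R, rkhs (k tau))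
  (K : forall tau : R, H -> Hk tau)
  (k_gt0 : forall (tau : R) x y, 0 < tau -> 0 < k tau x y)
  (k_bounded : forall tau : R, 0 < tau -> bounded_kernel (k tau))
  (k_continuous : forall tau : R, 0 < tau -> continuous_kernel (k tau))
  (k_spd : forall tau : R, 0 < tau -> strictly_positive_definite (k tau))
  (k_C1 : forall tau : R, 0 < tau -> C1_kernel c (k tau))
  (K_integral : forall tau : R, 0 < tau -> is_integral_operator (K tau))
  (K_adjoint : forall tau : R, 0 < tau ->
     is_adjoint (K tau) (@rk_class _ _ _ H _ (Hk tau)))
  (K1 : forall (tau : R) (f : H), 0 < tau -> f != 0 -> 0 < hdot f (Gop K tau f))
  (K2_one : forall tau : R, 0 < tau ->
     Gop K tau (cls H (fun=> 1)) = cls H (fun=> 1))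
  (K2_ge0 : forall (tau : R) (f : H), 0 < tau -> L2_ge0 f -> L2_ge0 (Gop K tau f))
  (K3 : forall (tau tau' : R) (f : H), 0 <= tau -> 0 <= tau' ->
     Gop K tau (Gop K tau' f) = Gop K (tau + tau') f)
  (K4 : forall f : H, Gop K tau f @[tau --> (0 : R)^'+] --> f)
  (k_markov : forall (tau : R) (x : X), 0 < tau -> M x ->
     cintegral mu (fun y => (k tau x y)%:C%C) = 1)
  (* polar decomposition and nesting of the RKHSs *)
  (T : forall tau : R, H -> Hk tau) (Tadj : forall tau : R, Hk tau -> H)
  (T_isometry : forall tau : R, 0 < tau -> is_isometry (T tau))
  (T_adjoint : forall tau : R, 0 < tau -> is_adjoint (T tau) (Tadj tau))
  (T_range : forall tau : R, 0 < tau -> range (T tau) = rk_sub (Hk tau) Xmu)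
  (K_polar : forall (tau : R) (f : H), 0 < tau -> K tau f = T tau (Gop K (tau / 2) f))
  (K_range : forall tau : R, 0 < tau ->
     rk_eval (Hk (tau / 2)) @` range (K (tau / 2)) =
     rk_eval (Hk tau) @` rk_sub (Hk tau) Xmu)
  (Hk_nested : forall (tau sigma : R) (h : Hk sigma), 0 < tau -> tau <= sigma ->
     exists2 g : Hk tau, rk_eval (Hk tau) g = rk_eval (Hk sigma) h & hnorm g <= hnorm h)
  (* regularized generators *)
  (Vreg : R -> operator H) (Ureg : forall tau : R, R -> Hk tau -> Hk tau)
  (V1 : forall tau : R, 0 < tau -> skew_adjoint (Vreg tau))
  (V2 : forall tau : R, 0 < tau -> compact_or_compact_resolvent (Vreg tau))
  (V3 : forall tau : R, 0 < tau -> commutes_with_conj (Vreg tau))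
  (V4 : forall tau : R, 0 < tau -> dom (Vreg tau) (cls H (fun=> 1)) /\
     Vreg tau (cls H (fun=> 1)) = 0)
  (V5 : strong_resolvent_cvg Vreg V)
  (Ureg_exp : forall tau : R, 0 < tau ->
     is_exponential
       (regularized_generator_rkhs (T tau) (Tadj tau) (Vreg tau))
       (Ureg tau))
  (Ureg_cvg : forall (tau0 : R) (f : Hk tau0) (t : R), 0 < tau0 ->
     hnorm (rk_class H (Ureg tau t (rk_incl (Hk tau0) (Hk tau) f)) - U t (rk_class H f))
       @[tau --> (0 : R)^'+] --> (0 : R))
  (* weighted Fock spaces and lifted dynamics *)
  (w : nat -> R) (w_weight : fock_weight w)
  (F : forall tau : R, fock_algebra w (Hk tau))
  (Ulift : forall tau : R, R -> F tau -> F tau)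
  (Rflow : forall tau : R, R -> spectrum (F tau) -> spectrum (F tau))
  (Ulift_unitary : forall tau t : R, 0 < tau -> unitary_op (Ulift tau t))
  (Ulift_lift : forall tau t : R, 0 < tau -> fock_lift (Ureg tau t) (Ulift tau t))
  (Rflow_induced : forall tau t : R, 0 < tau ->
     is_induced_flow (Ulift tau t) (Rflow tau t))
  (* embedding of observables *)
  (kappa : X -> X -> R)
  (kappa_gt0 : forall x y : X, 0 < kappa x y)
  (kappa_bounded : bounded_kernel kappa)
  (kappa_continuous : continuous_kernel kappa)
  (kappa_peak : forall x y : X, x <> y -> kappa x y < kappa x x)
  (KK : nat -> forall tau : R, H -> F tau)
  (KK_integral : forall (m : nat) (tau : R) (f : X -> R[i]), (0 < m)%N -> 0 < tau ->
     square_integrable mu f ->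
     is_weak_integral mu
       (fun y => vpow (F tau) m
          (K tau (iotaM H M (fun x => (kappa x y)%:C%C))))
       f (KK m tau (cls H f)))
  (* feature map *)
  (phi_mu : forall sigma : R, X -> Hk sigma)
  (phi_mu_projection : forall (sigma : R) (x : X), 0 < sigma ->
     is_orthogonal_projection (rk_sub (Hk sigma) Xmu)
       (rk_section (Hk sigma) x) (phi_mu sigma x))
  (J : forall sigma tau : R, F sigma -> F tau)
  (J_lift : forall sigma tau : R, 0 < tau -> tau <= sigma ->
     fock_lift (rk_incl (Hk sigma) (Hk tau)) (J sigma tau))
  (phi_hat : forall sigma tau : R, X -> spectrum (F tau))
  (phi_hatE : forall (sigma tau : R) (x : X) (a : F tau), 0 < tau -> tau <= sigma / 2 ->
     phi_hat sigma tau x a =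
     hdot (J sigma tau (fock_feature (F sigma) (rk_varpi (Hk sigma)) (phi_mu sigma x)))
          a) :
  forall f : X -> R[i], {within M, continuous f} -> forall t : R,
  exists (L1 : nat -> R -> R) (L2 : nat -> R),
    [/\ forall (m : nat) (sigma : R), (0 < m)%N -> 0 < sigma ->
          hnorm (iotaM H M (prediction (Rflow tau t)
                   (KK m tau (iotaM H M f)) (KK m tau (cls H (fun=> 1)))
                   (phi_hat sigma tau))
                 - U t (iotaM H M f))
            @[tau --> (0 : R)^'+] --> L1 m sigma,
        forall m : nat, (0 < m)%N -> L1 m sigma @[sigma --> (0 : R)^'+] --> L2 m &
        L2 m @[m --> \oo] --> (0 : R)].
Proof.
move=> f cf t.
have X_haus := metrizable_hausdorff X_metrizable.
set g := patch (fun=> 0) M f.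
have mg : cmeasurable (g : borel X -> R[i]).
  exact: patch_cmeasurable (M_closed M_compact X_haus) cf.
have [Bf Bf0 gB] := patch_bounded M_compact cf.
have [B kB] := kappa_bounded.
have sqf := patch_continuous_square_integrable Xmu_support Xmu_M M_compact X_haus cf.
have sq1 : square_integrable mu (fun=> 1 : R[i]) by exact: square_integrable_cst.
have Ureg_group tau : 0 < tau -> unitary_group (Ureg tau) by move=> /Ureg_exp[].
have dist_continuous (u : H) : continuous (fun z : H => rnorm (z - u)).
  apply: lipschitz1_continuous => y z; apply: le_trans (rnormB_le _ _) _.
  by rewrite opprB addrA subrK.
pose s m z := wratio mu m g (fun y => (kappa z y)%:C%C).
(* The inner limits are given explicitly. The one in [sigma] would be the distance of
   [U t (iotaM H M (s m))] from [U t (iotaM H M f)]; unitarity removes [U t] from it. *)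
exists (fun m sigma => rnorm (iotaM H M (orbit_ratio M kappa U Hk m g t sigma) - U t (iotaM H M f))).
exists (fun m => rnorm (iotaM H M (s m) - iotaM H M f)).
split.
- move=> m sigma m0 s0.
  have [low low0 lowP] := wavg_orbit_lower Xmu_support Xmu_M M_compact X_haus kappa_gt0
    kappa_bounded kappa_continuous Phi_flow mu_invariant U_koopman U_group k_gt0
    k_bounded k_continuous K_integral K_adjoint k_markov m.
  pose q := feature_orbit H Ureg phi_mu t sigma.
  have q_cont : \forall tau \near (0 : R)^'+, continuous (q tau).
    apply: filterS2 (nbhs_right_gt 0) (nbhs_right_le s0) => tau t0 ts.
    exact: (feature_orbit_continuous k_bounded k_continuous K_adjoint K3 Hk_nested
      Ureg_group phi_mu_projection).
  have qL x : M x -> rnorm (section_orbit U Hk t sigma x) <= rk_varpi (Hk sigma).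
    by move=> _; exact: (rnorm_section_orbit U_group k_bounded k_continuous K_adjoint K3 Hk_nested).
  have q_cvg (e : R) : 0 < e -> \forall tau \near (0 : R)^'+, forall x, M x ->
      rnorm (section_orbit U Hk t sigma x - q tau x) < e.
    exact: (feature_orbit_cvg Xmu_support U_group k_bounded k_continuous K_adjoint K3
      Hk_nested Ureg_group Ureg_cvg phi_mu_projection t M_compact s0).
  have orbit_cvg := orbit_wratio_cvg Xmu_support Xmu_M M_compact X_haus kappa_gt0
    kappa_bounded kappa_continuous (m := m) mg gB
    (section_orbit_continuous U_group k_gt0 k_bounded k_continuous s0 (t := t))
    q_cont qL low0 (fun x Mx => lowP sigma t x s0 Mx) q_cvg.
  have norm_cvg : rnorm (iotaM H M (orbit_wratio (H := H) M kappa m g (q tau)) - U t (iotaM H M f))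
      @[tau --> (0 : R)^'+] --> rnorm (iotaM H M (orbit_ratio M kappa U Hk m g t sigma) - U t (iotaM H M f)).
    exact: (cvg_comp _ _ orbit_cvg (dist_continuous (U t (iotaM H M f)) _)).
  apply: cvg_trans norm_cvg; apply: near_eq_cvg.
  have s20 : 0 < sigma / 2 by rewrite divr_gt0.
  (* The characters [phi_hat] are specified only for [tau <= sigma / 2], so the predictor is
     identified with the quotient only for such [tau]. *)
  apply: filterS2 (nbhs_right_gt 0) (nbhs_right_le s20) => tau t0 ts2.
  have ts : tau <= sigma by apply: le_trans ts2 _; rewrite ler_pdivrMr // mulr_natr mulr2n lerDl ltW.
  congr (rnorm (iotaM H M _ - _)); apply/funext => x.
  (* The weight is carried from [Hk tau] to [H]: [Ureg tau t] moves across as [Ureg tau (- t)], and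
     [K tau] as its adjoint, the class map. *)
  have aE y : hdot (rk_incl (Hk sigma) (Hk tau) (phi_mu sigma x))
      (Ureg tau t (K tau (kappa_class H M kappa y))) = hdot (q tau x) (kappa_class H M kappa y).
    have KE (h : Hk tau) (u : H) : hdot (rk_class H h) u = hdot h (K tau u).
      by rewrite hdotC -K_adjoint // -hdotC.
    by rewrite /q /feature_orbit KE (unitaryV (Ureg_group tau t0)).
  have mq := hdot_kappa_class_cmeasurable (H := H) Xmu_support Xmu_M M_compact X_haus
    kappa_continuous (q tau x).
  (* The identification is made at every [x] of [X], so the bound on the weight is allowed to depend
     on [x]. *)
  have qB y : rnorm (hdot (q tau x) (kappa_class H M kappa y)) <= rnorm (q tau x) * B.
    apply: le_trans (rnorm_hdot _ _) _; rewrite ler_wpM2l ?rnorm_ge0 //.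
    exact: (rnorm_kappa_class Xmu_support Xmu_M M_compact X_haus kappa_gt0 kappa_continuous).
  have sqE (u : X -> R[i]) :
      square_integrable mu (fun y => hdot (q tau x) (kappa_class H M kappa y) ^+ m * u y) ->
      square_integrable mu (fun y => hdot (rk_incl (Hk sigma) (Hk tau) (phi_mu sigma x))
        (Ureg tau t (K tau (kappa_class H M kappa y))) ^+ m * u y).
    by move=> h; under [X in square_integrable _ X]eq_fun do rewrite aE.
  have phi_le : rnorm (phi_mu sigma x) <= rk_varpi (Hk sigma).
    apply: le_trans (rnorm_section_le (k_bounded _ s0) x).
    exact: projection_le (phi_mu_projection _ x s0).
  rewrite (prediction_wratio H w_weight (J_lift _ _ t0 ts) (Ulift_unitary _ t t0)
    (Ulift_lift _ t t0) (Rflow_induced _ t t0) (KK_integral m _ _ m0 t0 sqf)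
    (KK_integral m _ _ m0 t0 sq1) (varpi_gt0 (k_bounded _ s0) (k_gt0 _ x x s0))
    phi_le (fun a => phi_hatE _ _ x a t0 ts2)).
  + by congr (wratio mu m g _); apply/funext => y; exact/esym/aE.
  + exact/sqE/(wavg_square_integrable m mg mq gB qB).
  + apply: (sqE (fun=> 1)); apply: (wavg_square_integrable m _ mq (Bf := 1) _ qB).
      exact: cmeasurable_cst.
    by move=> y; rewrite rnorm1.
- move=> m m0.
  have P_cvg : iotaM H M (orbit_ratio M kappa U Hk m g t sigma) @[sigma --> (0 : R)^'+] -->
      U t (iotaM H M (s m)).
    apply/cvg_rnorm0P; under eq_fun do rewrite rdistC.
    exact: (smoothing_limit Xmu_support Xmu_M M_compact X_haus kappa_gt0
      kappa_bounded kappa_continuous Phi_flow mu_invariant U_koopman U_group k_gt0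
      k_bounded k_continuous K_integral K_adjoint K4 k_markov m t cf).
  rewrite -(U_rnormB U_group t).
  exact: (cvg_comp _ _ P_cvg (dist_continuous (U t (iotaM H M f)) _)).
- apply/cvgrPdist_lt => e e0; have e2 : 0 < e / 2 by rewrite divr_gt0.
  have := wratio_concentration Xmu_support Xmu_compact Xmu_M M_compact X_haus (H := H)
    kappa_gt0 kappa_bounded kappa_continuous kappa_peak cf e2.
  apply: filterS => m near_f; rewrite sub0r normrN ger0_norm ?rnorm_ge0 //.
  apply: (@le_lt_trans _ _ (e / 2)); last by rewrite ltr_pdivrMr // mulr_natr mulr2n ltrDl.
  have sqs : square_integrable mu (patch (fun=> 0) M (s m)).
    apply: (patch_continuous_square_integrable Xmu_support Xmu_M M_compact X_haus).
    exact: (wratio_kappa_continuous Xmu_support Xmu_M (H := H) M_compact kappa_gt0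
      kappa_bounded kappa_continuous mg gB).
  by apply: (rnorm_iotaM_dist Xmu_support Xmu_M sqs sqf); [exact: ltW|exact: near_f].
Qed.
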